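(* Let $\pi$ be a fixed meta-prior on $\mathcal{A}$, $\mathfrak{P}(A)$ a fixed data-independent family as below, $\delta>0$, $\lambda_M>0$ and $\lambda_1,\dots,\lambda_n>0$ fixed. Then with probability at least $1-\delta$ over the sampling of the training tasks and datasets, simultaneously for all meta-posteriors $\rho$ and hyper-posteriors $\mathcal{Q}(A)$, $$\mathcal{R}^T_M(\rho)\;\le\;\Phi^{-1}_n\!\left(\Phi^{-1}_{m_1,\dots,m_n}\Big(\widehat{\mathcal{R}}_1(\rho),\dots,\widehat{\mathcal{R}}_n(\rho)\,\Big|\,C(\rho),\lambda_1,\dots,\lambda_n\Big)\,\Big|\,\mathrm{KL}(\rho\|\pi)+\log\frac2\delta,\ \lambda_M\right),$$ where $C(\rho)=\mathrm{KL}(\rho\|\pi)+\mathbb{E}_{A\sim\rho}[\mathrm{KL}(\mathfrak{Q}(A)\|\mathfrak{P}(A))]+\log\frac2\delta$.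
   Context: Meta-learning setting: $\tau$ is an unknown environment distribution over triples $(D,m,S)$, $D$ a distribution on $\mathcal{Z}$, $m\in\{1,\dots,m_{\max}\}$, $S$ consisting of $m$ i.i.d. samples from $D$. Training tasks $(D_i,m_i,S_i)$, $i=1,\dots,n$, are i.i.d. from $\tau$. A loss $\ell:\mathcal{F}\times\mathcal{Z}\to[0,1]$ is fixed; $\ell(z,Q)=\mathbb{E}_{f\sim Q}\ell(f,z)$. Each algorithm $A\in\mathcal{A}$ maps a dataset $S$ to a posterior $A(S)$ (distribution on $\mathcal{F}$). Meta-prior $\pi$ (data-independent) and meta-posterior $\rho$ are distributions on $\mathcal{A}$. For each $A$, $\mathcal{P}(A)$ is a data-independent hyper-prior and $\mathcal{Q}(A)$ a data-dependent hyper-posterior (distributions on distributions over $\mathcal{F}$); $\mathfrak{Q}(A)=\mathcal{Q}(A)\times A(S_1)\times\cdots\times A(S_n)$, and $\mathfrak{P}(A)$ is generated by $P\sim\mathcal{P}(A)$, then $f_1,\dots,f_n$ i.i.d. $\sim P$. $\widehat{\mathcal{R}}_i(\rho)=\mathbb{E}_{A\sim\rho}\frac1{m_i}\sum_{z\in S_i}\ell(z,A(S_i))$; $\mathcal{R}^T_M(\rho)=\mathbb{E}_{A\sim\rho}\mathbb{E}_{(D,m,S)\sim\tau}\mathbb{E}_{z\sim D}\ell(z,A(S))$. Catoni inverses: $\Phi^{-1}_{m_1,\dots,m_n}(q_1,\dots,q_n|b,\lambda_1,\dots,\lambda_n)=\sup\{\frac1n\sum_ip_i:-\sum_i m_i\log(1-p_i+p_ie^{-\lambda_i/(nm_i)})\le\frac1n\sum_i\lambda_iq_i+b,\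 p_i\in[0,1]\}$, and for a single integer $N$, $\Phi^{-1}_N(q|b,\lambda)=\sup\{p\in[0,1]:-N\log(1-p+pe^{-\lambda/N})\le\lambda q+b\}$. $\mathrm{KL}$ is the Kullback–Leibler divergence. *)

(* Defs.v *)
From HB Require Import structures.
From mathcomp Require Import all_boot all_order all_algebra.
From mathcomp Require Import all_classical all_reals all_analysis.
From mathcomp Require Import measurable_realfun.
From mathcomp Require Import giry.
Set Implicit Arguments.
Unset Strict Implicit.
Unset Printing Implicit Defensive.
Import Order.TTheory GRing.Theory Num.Theory.
Local Open Scope classical_set_scope.
Local Open Scope ring_scope.

Section MetaDefs.
Context {R : realType}.

(* Iterated integrals over tuples: integrates g : k.-tuple T -> \bar R *)
(* against mus 0 (x) mus 1 (x) ... (x) mus (k-1) (product measure, as  *)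
(* an iterated integral, first coordinate outermost).                 *)
Fixpoint tupleIntF {d} {T : measurableType d} (k : nat) :
  ('I_k -> {measure set T -> \bar R}) -> (k.-tuple T -> \bar R) -> \bar R :=
  match k return ('I_k -> {measure set T -> \bar R}) ->
                 (k.-tuple T -> \bar R) -> \bar R with
  | 0 => fun _ g => g [tuple]
  | k'.+1 => fun mus g =>
      (\int[mus ord0]_x
         tupleIntF (fun j : 'I_k' => mus (lift ord0 j))
                   (fun t : k'.-tuple T => g [tuple of x :: t]))%E
  end.

Definition tupleInt {d} {T : measurableType d}
  (mu : {measure set T -> \bar R}) (k : nat) (g : k.-tuple T -> \bar R) : \bar R :=
  tupleIntF (fun _ => mu) g.
Arguments tupleInt {d T} mu k g.

Fixpoint iterFun {X : Type} (I : (X -> \bar R) -> \bar R) (k : nat) :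
  (k.-tuple X -> \bar R) -> \bar R :=
  match k return (k.-tuple X -> \bar R) -> \bar R with
  | 0 => fun g => g [tuple]
  | k'.+1 => fun g => I (fun x => iterFun I (fun t : k'.-tuple X => g [tuple of x :: t]))
  end.

(* Kullback-Leibler divergence of (finite) set functions on a         *)
(* measurable type, via the Gelfand-Yaglom-Perez / Dobrushin formula: *)
(* supremum over finite measurable partitions (A_k) of                 *)
(*   sum_k mu(A_k) log (mu(A_k) / nu(A_k))                             *)
(* with 0 log(0/b) = 0 and a log(a/0) = +oo for a > 0.                 *)
Definition klterm (a b : \bar R) : \bar R :=
  if a == 0%E then 0%E
  else if b == 0%E then +oo%E
  else (a * (ln (fine a / fine b))%:E)%E.

Definition KL {d} {T : measurableType d} (mu nu : set T -> \bar R) : \bar R :=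
  ereal_sup [set x | exists (K : nat) (A : 'I_K -> set T),
    [/\ (forall k, measurable (A k)), trivIset setT A,
        \bigcup_(k in setT) A k = setT &
        x = (\sum_(k < K) klterm (mu (A k)) (nu (A k)))%E]].

Definition PhiInv (N : nat) (q : R) (b : \bar R) (lam : R) : R :=
  sup [set p : R | 0 <= p <= 1 /\
    ((- (N%:R * ln (1 - p + p * expR (- (lam / N%:R)))))%:E
       <= (lam * q)%:E + b)%E].

Definition PhiInvMulti (n : nat) (m : 'I_n -> nat) (q : 'I_n -> R)
  (b : \bar R) (lam : 'I_n -> R) : R :=
  sup [set s : R | exists p : 'I_n -> R,
    [/\ (forall i, 0 <= p i <= 1),
        ((- \sum_(i < n) (m i)%:R *
              ln (1 - p i + p i * expR (- (lam i / (n%:R * (m i)%:R)))))%:E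
          <= (n%:R^-1 * \sum_(i < n) lam i * q i)%:E + b)%E &
        s = n%:R^-1 * \sum_(i < n) p i]].

Context {dZ dF dA : measure_display}
  {Z : measurableType dZ} {F : measurableType dF} {Alg : measurableType dA}.

(* A (training) task outcome: ((D, m), zs) where zs are mmax i.i.d.   *)
(* draws from D, of which the dataset S consists of the first m.      *)
Definition taskOutcome (mmax : nat) : Type :=
  ((giry Z R * nat) * mmax.-tuple Z)%type.

Definition taskD {mmax} (t : taskOutcome mmax) : giry Z R := t.1.1.
Definition taskm {mmax} (t : taskOutcome mmax) : nat := t.1.2.
Definition taskS {mmax} (t : taskOutcome mmax) : seq Z := take t.1.2 (tval t.2).

Definition taskInt (tau0 : probability (giry Z R * nat)%type R) (mmax : nat)
  (g : taskOutcome mmax -> \bar R) : \bar R :=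
  (\int[tau0]_p tupleInt (p.1 : {measure set Z -> \bar R}) mmax
                 (fun zs => g (p, zs)))%E.

Definition sampleProb (tau0 : probability (giry Z R * nat)%type R) (mmax n : nat)
  (G : set (n.-tuple (taskOutcome mmax))) : \bar R :=
  iterFun (taskInt tau0 (mmax := mmax)) (fun w => (\1_G w)%:E).

Definition lossQ (loss : F -> Z -> R) (Q : {measure set F -> \bar R}) (z : Z)
  : \bar R := (\int[Q]_f (loss f z)%:E)%E.

Definition empRisk (loss : F -> Z -> R) (post : Alg -> seq Z -> probability F R)
  (rho : probability Alg R) (m : nat) (S : seq Z) : R :=
  fine (\int[rho]_A ((m%:R^-1)%:E *
          \sum_(z <- S) lossQ loss (post A S) z))%E.

Definition metaRisk (loss : F -> Z -> R) (post : Alg -> seq Z -> probability F R)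
  (tau0 : probability (giry Z R * nat)%type R) (rho : probability Alg R) : \bar R :=
  (\int[rho]_A \int[tau0]_p
     tupleInt (p.1 : {measure set Z -> \bar R}) p.2
       (fun S => \int[(p.1 : {measure set Z -> \bar R})]_z
                    lossQ loss (post A (tval S)) z))%E.

Definition frakQ {n : nat} (post : Alg -> seq Z -> probability F R)
  (Sd : 'I_n -> seq Z) (Qh : probability (giry F R) R) (A : Alg)
  (B : set (giry F R * n.-tuple F)%type) : \bar R :=
  (\int[Qh]_P tupleIntF (fun i => (post A (Sd i) : {measure set F -> \bar R}))
                (fun fs => (\1_B (P, fs))%:E))%E.

Definition frakP {n : nat} (Ph : probability (giry F R) R)
  (B : set (giry F R * n.-tuple F)%type) : \bar R :=
  (\int[Ph]_P tupleInt (P : {measure set F -> \bar R}) n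
                (fun fs => (\1_B (P, fs))%:E))%E.

End MetaDefs.

(* Main.v *)
Require Import Defs.
From HB Require Import structures.
From mathcomp Require Import all_boot all_order all_algebra.
From mathcomp Require Import all_classical all_reals all_analysis.
From mathcomp Require Import measurable_realfun.
From mathcomp Require Import giry.
From mathcomp Require Import ring lra.
Import Order.TTheory GRing.Theory Num.Theory.
Local Open Scope classical_set_scope.
Local Open Scope ring_scope.
Set Implicit Arguments.
Unset Strict Implicit.
Unset Printing Implicit Defensive.

(** Both levels rest on the change-of-measure inequality of Donsker and Varadhan,
    an exponential moment bounded by 1 (convexity of [exp] and independence),
    Markov's inequality, and Jensen's inequality for [-ln]; the two resulting
    events each fail with probability at most [delta / 2].

    The environment level uses the prior [pi].  At the task level the natural prior
    on [(A, f_1, ..., f_n)] is not available, because [Ph] is not assumed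
    measurable in [A].  Instead [pi] is extended to a finitely additive mean on all
    bounded functions (an ultrafilter limit of Riemann sums over finite measurable
    partitions); averaging the laws of [(f_1, ..., f_n)] over it gives a finitely
    additive content, whose countably additive part is an honest measure to which
    Fubini applies.  Nothing is lost by discarding the rest of the content: up to an
    event of arbitrarily small posterior probability the two coincide, so Gibbs'
    inequality for each [A] still integrates to the same bound. *)

(** * Relative entropy over finite partitions *)

(** Uniformity in [rho] and [Qh] comes from the order of choices: the two good events are defined
    from [pi] and the priors [Ph] alone, and change of measure is applied afterwards, sample by
    sample. At the task level the expectation over samples must be exchanged with the average over
    the prior; a merely finitely additive average does not allow this, which is why an honest
    measure has to be extracted. The hyper-posterior enters only through the divergence: projecting
    to [(f_1, ..., f_n)] can only decrease it, and the projection of [frakQ] does not depend on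
    [Qh]. The levels are linked by the [rho]-averaged true risks of the training tasks: their mean
    is bounded by the inner inverse, and it is the [q] of the outer constraint, which is monotone in
    [q]. Elements of [giry] are subprobabilities, so moments are bounded by 1 rather than computed,
    and total mass 1 is a separate fact wherever a constant must integrate to itself. *)

Section Gibbs.
Context {R : realType}.

(** This is [q] times the inequality [ln x <= x - 1] at [x = p * expR u / (q * c)]: the
    Fenchel-Young inequality for one cell, with [c] as normalising constant. *)
Lemma klterm_ge (q p u c : R) : 0 <= q -> 0 <= p -> 0 < c ->
  ((q * u - q * ln c + q - p * expR u / c)%:E <= klterm q%:E p%:E)%E.
Proof.
move=> q0 p0 c0; rewrite /klterm !eqe.
case: (eqVneq q 0) => [->|qn0].
  rewrite !mul0r subr0 !add0r lee_fin oppr_le0.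
  by apply: divr_ge0; [apply: mulr_ge0 => //; exact: expR_ge0|exact: ltW].
case: (eqVneq p 0) => [->|pn0]; first by rewrite leey.
have {qn0}q0 : 0 < q by rewrite lt_neqAle eq_sym qn0.
have {pn0}p0 : 0 < p by rewrite lt_neqAle eq_sym pn0.
rewrite -EFinM lee_fin /=.
have H := expR_ge1Dx (ln p + u - ln q - ln c).
rewrite !expRD !expRN !lnK ?posrE// in H.
rewrite ln_div ?posrE//.
have -> : p * expR u / c = q * (p * expR u / q / c) by field; rewrite !gt_eqF.
rewrite -subr_ge0 [leRHS](_ : _ =
  q * (p * expR u / q / c - (1 + (ln p + u - ln q - ln c)))); last by ring.
by rewrite mulr_ge0 ?subr_ge0// ltW.
Qed.

(** Sum [klterm_ge] over the cells: since [q] has total mass 1 and the exponential sum is at most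
    [c], the last two terms together contribute at least 0. *)
Lemma gibbs K (q p u : 'I_K -> R) (c : R) :
  (forall k, 0 <= q k) -> (forall k, 0 <= p k) -> \sum_k q k = 1 -> 0 < c ->
  \sum_k p k * expR (u k) <= c ->
  ((\sum_k q k * u k)%:E <= \sum_k klterm (q k)%:E (p k)%:E + (ln c)%:E)%E.
Proof.
move=> q0 p0 q1 c0 pc; rewrite -leeBlDr// -EFinB.
apply: (@le_trans _ _
  (\sum_k (q k * u k - q k * ln c + q k - p k * expR (u k) / c)%:E)%E); last first.
  by apply: lee_sum => k _; exact: klterm_ge.
rewrite sumEFin lee_fin big_split/= big_split/= big_split/= !sumrN.
rewrite -!mulr_suml q1 mul1r.
have : (\sum_k p k * expR (u k)) / c <= 1 by rewrite ler_pdivrMr// mul1r.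
lra.
Qed.

Context {d : measure_display} {T : measurableType d}.

Lemma KL_partition_ge (mu nu : set T -> \bar R) K (A : 'I_K -> set T)
    (q p u : 'I_K -> R) (c : R) :
  (forall k, measurable (A k)) -> trivIset setT A ->
  \bigcup_(k in setT) A k = setT ->
  (forall k, mu (A k) = (q k)%:E) -> (forall k, nu (A k) = (p k)%:E) ->
  (forall k, 0 <= q k) -> (forall k, 0 <= p k) -> \sum_k q k = 1 -> 0 < c ->
  \sum_k p k * expR (u k) <= c ->
  ((\sum_k q k * u k)%:E <= KL mu nu + (ln c)%:E)%E.
Proof.
move=> mA tA UA muA nuA q0 p0 q1 c0 pc.
apply: (le_trans (gibbs q0 p0 q1 c0 pc)); rewrite leeD2r//.
apply: ereal_sup_ubound; exists K, A; split => //.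
by apply: eq_bigr => k _; rewrite muA nuA.
Qed.

(** The one-cell partition with [u = 0] and [c = 1] already gives the bound. Mass at most 1 is what
    a prior built in [giry] provides. *)
Lemma KL_ge0 (mu nu : set T -> \bar R) :
  mu setT = 1%E -> (0 <= nu setT <= 1)%E -> (0 <= KL mu nu)%E.
Proof.
move=> mu1 /andP[nu0 nu1].
have nuE : nu setT = (fine (nu setT))%:E.
  by rewrite fineK// ge0_fin_numE// (le_lt_trans nu1)// ltry.
have := @KL_partition_ge mu nu 1 (fun=> setT) (fun=> 1) (fun=> fine (nu setT))
  (fun=> 0) 1.
rewrite ln1 adde0 !big_ord_recl !big_ord0 mulr0 !addr0 expR0 mulr1.
apply=> //; last 2 first.
- by move=> _; rewrite fine_ge0.
- by rewrite -lee_fin -nuE.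
- by move=> [[|//] ?] [[|//] ?] _ _ _; exact/val_inj.
- by apply/seteqP; split=> // x _; exists ord0.
Qed.

End Gibbs.

(** * Step functions approximating a bounded measurable function *)

Section Discretize.
Context {R : realType} {d : measure_display} {T : measurableType d}.

(** The cells are the preimages of consecutive half-open intervals of length [e] starting at [- b].
    The lower values stay in [[- b, b]], so later error terms depend on [b] and not on the
    partition. *)
Lemma discretize (v : T -> R) (b e : R) : measurable_fun setT v -> 0 < e ->
  (forall x, `|v x| <= b) ->
  exists K (A : 'I_K -> set T) (c : 'I_K -> R),
  [/\ forall k, measurable (A k), trivIset setT A,
      \bigcup_(k in setT) A k = setT,
      forall k x, A k x -> c k <= v x <= c k + e & forall k, `|c k| <= b].
Proof.
move=> mv e0 vb.
have b0 : 0 <= b := le_trans (normr_ge0 _) (vb point).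
pose f x := Num.trunc ((v x + b) / e).
have f_itv x : (f x)%:R * e - b <= v x < (f x)%:R * e - b + e.
  have : 0 <= (v x + b) / e.
    by apply: divr_ge0; [have := vb x; rewrite ler_norml; lra|exact: ltW].
  move=> /truncn_itv; rewrite -/(f x) ler_pdivlMr// ltr_pdivrMr// -natr1; lra.
pose K := (Num.trunc (b *+ 2 / e)).+1.
have fK x : (f x < K)%N.
  rewrite ltnS; apply: le_truncn; rewrite ler_pM2r ?invr_gt0// mulr2n lerD2r.
  by have := vb x; rewrite ler_norml => /andP[].
exists K, (fun k => [set x | f x = k]), (fun k : 'I_K => k%:R * e - b).
split.
- move=> k.
  have -> : [set x | f x = k :> nat] =
      v @^-1` `[(k%:R * e - b), (k%:R * e - b + e)[%classic.
    apply/seteqP; split=> [x /= <-|x /=]; first by rewrite in_itv/= f_itv.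
    rewrite in_itv/= => /andP[h1 h2]; apply/eqP.
    have /andP[h3 h4] := f_itv x.
    have h5 : (f x)%:R < k%:R + 1 :> R by rewrite -(ltr_pM2r e0); lra.
    have h6 : k%:R < (f x)%:R + 1 :> R by rewrite -(ltr_pM2r e0); lra.
    by move: h5 h6; rewrite !natr1 !ltr_nat !ltnS eqn_leq => -> ->.
  by rewrite -[X in measurable X]setTI; exact: mv.
- by move=> i j _ _ [x [/= fi fj]]; apply: val_inj; rewrite /= -fi -fj.
- by apply/seteqP; split=> // x _; exists (Ordinal (fK x)).
- by move=> k x <-; have := f_itv x; lra.
- move=> k; have : (k%:R : R) <= b *+ 2 / e.
    have /truncn_itv/andP[h _] : 0 <= b *+ 2 / e.
      by apply: divr_ge0; [rewrite mulrn_wge0|exact: ltW].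
    by apply: le_trans h; rewrite ler_nat -ltnS.
  rewrite ler_pdivlMr// mulr2n ler_norml => ?.
  have : 0 <= k%:R * e by rewrite mulr_ge0// ltW.
  lra.
Qed.

Lemma integral_partition_le (mu : subprobability T R) K (A : 'I_K -> set T)
    (c : 'I_K -> R) (v : T -> R) (b : R) :
  (forall k, measurable (A k)) -> trivIset setT A ->
  \bigcup_(k in setT) A k = setT ->
  measurable_fun setT v -> (forall x, `|v x| <= b) ->
  (forall k x, A k x -> v x <= c k) ->
  (\int[mu]_x (v x)%:E <= \sum_k mu (A k) * (c k)%:E)%E.
Proof.
move=> mA tA UA mv vb vc.
have iv : mu.-integrable setT (EFin \o v).
  apply: (@le_integrable _ _ _ mu setT measurableT _ (EFin \o cst b)) => //.
  - exact/measurable_EFinP.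
  - move=> x _ /=; rewrite lee_fin (le_trans (vb x))//.
    exact: ler_norm.
  - exact: finite_measure_integrable_cst.
have i1 k : mu.-integrable setT (fun x => ((c k)%:E * (\1_(A k) x)%:E)%E).
  by apply: integrableZl => //; exact: integrable_indic.
rewrite [leRHS](_ : _ = \int[mu]_x (\sum_k (c k)%:E * (\1_(A k) x)%:E))%E.
  apply: le_integral => //; first exact: integrable_sum.
  move=> x _; have : (\bigcup_(k in setT) A k) x by rewrite UA.
  move=> [k _ Akx]; rewrite (bigD1 k)//= indicE mem_set// mule1.
  rewrite big1 ?adde0 ?lee_fin ?(vc _ _ Akx)// => j jk.
  rewrite indicE memNset ?mule0// => Ajx.
  by move/eqP: jk; apply; apply: tA => //; exists x.
rewrite integral_sum//; apply: eq_bigr => k _.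
rewrite integralZl//; last exact: integrable_indic.
by rewrite integral_indic// setIT muleC.
Qed.

End Discretize.
(** * Finitely additive means *)

Section FinitelyAdditiveMean.
Import numFieldNormedType.Exports.
Context {R : realType} {d : measure_display} {T : measurableType d}.
Variable pi : probability T R.

(** A Riemann sum of [X] over the cells that the sets in [s] cut out of [E], tagged by a point
    chosen in each cell. An empty cell gets the tag [point], harmlessly, since its weight is 0.
    Indexing by lists of sets makes refinement mere list inclusion. *)
Fixpoint pmean (s : seq (set T)) (E : set T) (X : T -> R) : R :=
  if s is B :: s' then pmean s' (E `&` B) X + pmean s' (E `&` ~` B) X
  else fine (pi E) * X (xget point E).

Lemma pmeanD s E X Y : pmean s E (X \+ Y) = pmean s E X + pmean s E Y.
Proof.
elim: s E => [|B s IH] E /=; first by rewrite mulrDr.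
by rewrite !IH addrACA.
Qed.

Lemma pmeanZ s E a X : pmean s E (fun x => a * X x) = a * pmean s E X.
Proof.
elim: s E => [|B s IH] E /=; first by rewrite mulrCA.
by rewrite !IH mulrDr.
Qed.

Lemma le_pmean s E X Y : (forall x, X x <= Y x) -> pmean s E X <= pmean s E Y.
Proof.
move=> XY; elim: s E => [|B s IH] E /=; last by rewrite lerD.
by rewrite ler_wpM2l// fine_ge0.
Qed.

Lemma fine_probIC (E B : set T) : measurable E -> measurable B ->
  fine (pi (E `&` B)) + fine (pi (E `&` ~` B)) = fine (pi E).
Proof.
move=> mE mB; rewrite -setDE (measureDI pi mE mB) fineD ?fin_num_measure//.
- by rewrite addrC.
- exact: measurableD.
- exact: measurableI.
Qed.

Lemma pmean_cst s E c : (forall B, B \in s -> measurable B) -> measurable E ->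
  pmean s E (fun=> c) = fine (pi E) * c.
Proof.
elim: s E => [//|B s IH] E ms mE /=.
have mB : measurable B by apply: ms; rewrite mem_head.
have {}ms C : C \in s -> measurable C by move=> Cs; apply: ms; rewrite inE Cs orbT.
have mC := measurableC mB.
by rewrite !IH -?mulrDl ?fine_probIC//; exact: measurableI.
Qed.

(** The three-way hypothesis is the induction invariant: splitting by some [A k] in the list turns
    the first case into the second on one side and into the third on the other. At a leaf the list
    is empty, so the cell lies in a single [A k] and its tag satisfies the lower bound. *)
Lemma pmean_ge K (A : 'I_K -> set T) (c : 'I_K -> R) s E X :
  (forall k, measurable (A k)) -> trivIset setT A ->
  \bigcup_(k in setT) A k = setT ->
  (forall k x, A k x -> c k <= X x) ->
  (forall B, B \in s -> measurable B) -> measurable E ->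
  (forall k, [\/ A k \in s, E `<=` A k | E `&` A k = set0]) ->
  \sum_k fine (pi (A k `&` E)) * c k <= pmean s E X.
Proof.
move=> mA tA UA cX; elim: s E => [|B s IH] E ms mE H /=.
  have [->|/set0P[x Ex]] := eqVneq E set0.
    rewrite measure0 mul0r big1// => k _.
    by rewrite setI0 measure0 mul0r.
  set y := xget point E; have Ey : E y by exact: xgetI Ex.
  have : (\bigcup_(k in setT) A k) y by rewrite UA.
  move=> [k _ Aky]; rewrite (bigD1 k)//= big1 => [|j jk].
    rewrite addr0; case: (H k) => // [EA|EA0].
      by rewrite setIidr// ler_wpM2l ?fine_ge0// cX.
    by have : (E `&` A k) y by []; rewrite EA0.
  case: (H j) => // [EA|EA0]; last by rewrite setIC EA0 measure0 mul0r.
  by move/eqP: jk; case; apply: tA => //; exists y; split => //; exact: EA.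
have mB : measurable B by apply: ms; rewrite mem_head.
have {}ms C : C \in s -> measurable C by move=> Cs; apply: ms; rewrite inE Cs orbT.
have mC := measurableC mB.
have -> : \sum_k fine (pi (A k `&` E)) * c k =
   \sum_k fine (pi (A k `&` (E `&` B))) * c k
   + \sum_k fine (pi (A k `&` (E `&` ~` B))) * c k.
  rewrite -big_split/=; apply: eq_bigr => k _.
  by rewrite -mulrDl !setIA fine_probIC//; exact: measurableI.
apply: lerD; apply: IH => //; try exact: measurableI.
- move=> k; case: (H k) => [|EA|EA0].
  + rewrite inE => /orP[/eqP->|?]; last by constructor 1.
    by constructor 2; exact: subIsetr.
  + by constructor 2; apply: subset_trans EA; exact: subIsetl.
  + by constructor 3; rewrite setIAC EA0 set0I.
- move=> k; case: (H k) => [|EA|EA0].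
  + rewrite inE => /orP[/eqP->|?]; last by constructor 1.
    by constructor 3; rewrite -setIA setICl setI0.
  + by constructor 2; apply: subset_trans EA; exact: subIsetl.
  + by constructor 3; rewrite setIAC EA0 set0I.
Qed.

(** The filter of eventual properties of the net of finite measurable lists, directed by
    inclusion. *)
Definition refinements : set_system (seq (set T)) :=
  [set P | exists2 s0 : seq (set T), (forall B, B \in s0 -> measurable B) &
    forall s : seq (set T), (forall B, B \in s -> measurable B) ->
      {subset s0 <= s} -> P s].

Lemma refinements_proper : ProperFilter refinements.
Proof.
split; first by case=> s0 ms0 /(_ s0 ms0); apply.
split.
- by exists [::].
- move=> P Q [s ms Ps] [t mt Qt]; exists (s ++ t).
    by move=> B; rewrite mem_cat => /orP[/ms|/mt].
  move=> r mr str; split.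
    by apply: Ps => // B Bs; apply: str; rewrite mem_cat Bs.
  by apply: Qt => // B Bt; apply: str; rewrite mem_cat Bt orbT.
- by move=> P Q PQ [s ms Ps]; exists s => // r mr sr; exact/PQ/Ps.
Qed.

Definition bounded_fct (X : T -> R) := exists b, forall x, `|X x| <= b.

Lemma bounded_fctD X Y : bounded_fct X -> bounded_fct Y -> bounded_fct (X \+ Y).
Proof.
move=> [b Xb] [c Yc]; exists (b + c) => x.
by rewrite (le_trans (ler_normD _ _))// lerD.
Qed.

Lemma bounded_fctZ a X : bounded_fct X -> bounded_fct (fun x => a * X x).
Proof. by move=> [b Xb]; exists (`|a| * b) => x; rewrite normrM ler_wpM2l. Qed.

(** The last clause is how [L] extends [pi]: it dominates every lower step sum, also for functions
    that are not measurable. *)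
Lemma mean_exists : exists L : (T -> R) -> R,
  [/\ forall X Y, bounded_fct X -> bounded_fct Y -> L (X \+ Y) = L X + L Y,
      forall a X, bounded_fct X -> L (fun x => a * X x) = a * L X,
      L (fun=> 1) = 1 &
      forall K (A : 'I_K -> set T) (c : 'I_K -> R) X,
        (forall k, measurable (A k)) -> trivIset setT A ->
        \bigcup_(k in setT) A k = setT ->
        (forall k x, A k x -> c k <= X x) -> bounded_fct X ->
        \sum_k fine (pi (A k)) * c k <= L X].
Proof.
have [U [UU FU]] := ultraFilterLemma refinements_proper.
have PU : ProperFilter U by exact: ultra_proper.
have cvgU X : bounded_fct X -> cvg (pmean s setT X @[s --> U]).
  move=> [b Xb].
  (* The weights sum to 1, so all Riemann sums lie in this segment; the image of an ultrafilter is
     an ultrafilter, and on a compact set it converges. *)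
  have : compact `[-b, b] by exact: segment_compact.
  rewrite compact_ultra => /(_ (pmean s setT X @[s --> U])).
  have UX : UltraFilter (pmean s setT X @[s --> U]).
    split=> [|G PG UG]; first exact: fmap_proper_filter.
    apply/seteqP; split=> // A GA.
    have [//|UA] := in_ultra_setVsetC ((fun s => pmean s setT X) @^-1` A) UU.
    have GC : G (~` A) by exact: UG.
    have : G (A `&` ~` A) by exact: filterI.
    by rewrite setICr => /filter_not_empty.
  case=> //=.
    apply: FU; exists [::] => // s ms _ /=; rewrite in_itv/=.
    have H c : pmean s setT (fun=> c) = c.
      by rewrite pmean_cst// probability_setT mul1r.
    have Xb2 x : - b <= X x <= b by rewrite -ler_norml.
    rewrite -(H (- b)) -[X in _ && (_ <= X)](H b).
    by apply/andP; split; apply: le_pmean => x; case/andP: (Xb2 x).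
  by move=> l [_ Xl]; apply/cvg_ex; exists l.
exists (fun X => lim (pmean s setT X @[s --> U])); split.
- move=> X Y bX bY.
  under eq_fun do rewrite pmeanD.
  by apply: limD; exact: cvgU.
- move=> a X bX.
  under eq_fun do rewrite pmeanZ.
  apply: cvg_lim => //; apply: cvgM; first exact: cvg_cst.
  exact: cvgU.
- apply: lim_near_cst => //; apply: FU; exists [::] => // s ms _ /=.
  by rewrite pmean_cst// probability_setT mul1r.
- move=> K A c X mA tA UA cX bX.
  apply: limr_ge; first exact: cvgU.
  (* Once the list contains every [A k], each cell of the Riemann sum lies inside one of them. *)
  apply: FU; exists (map A (enum 'I_K)) => [B /mapP[k _ ->]//|s ms As].
  have := @pmean_ge K A c s setT X mA tA UA cX ms measurableT.
  under eq_bigr do rewrite setIT; apply.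
  by move=> k; constructor 1; apply/As/map_f; rewrite mem_enum.
Qed.

End FinitelyAdditiveMean.

(** * The countably additive part of a content *)

Section CountablyAdditivePart.
Context {R : realType} {d : measure_display} {T : measurableType d}.
Variable M : set T -> \bar R.
Hypothesis M_ge0 : forall B, (0 <= M B)%E.
Hypothesis MT : (M setT <= 1)%E.
Hypothesis MU : forall A B, measurable A -> measurable B -> A `&` B = set0 ->
  (M (A `|` B) = M A + M B)%E.

Let le_M A B : measurable A -> measurable B -> A `<=` B -> (M A <= M B)%E.
Proof.
move=> mA mB AB; rewrite -(setDUK AB) MU ?leeDl ?setDIK//.
exact: measurableD.
Qed.

Let M_fin A : measurable A -> M A \is a fin_num.
Proof.
move=> mA; rewrite ge0_fin_numE// (@le_lt_trans _ _ 1%E) ?ltry//.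
by rewrite (le_trans _ MT)// le_M.
Qed.

Let M0 : M set0 = 0%E.
Proof.
have := MU measurable0 measurable0 (set0I _); rewrite setU0.
have := M_fin measurable0; case: (M set0) => //= r _ [].
by move/eqP; rewrite -subr_eq0 opprD addrA subrr sub0r oppr_eq0 => /eqP ->.
Qed.

Let bigM (F : nat -> set T) n : (forall k, measurable (F k)) ->
  (M (\big[setU/set0]_(i < n) F i) <= \sum_(i < n) M (F i))%E.
Proof.
move=> mF; have mU k : measurable (\big[setU/set0]_(i < k) F i).
  exact: bigsetU_measurable.
elim: n => [|n IH]; first by rewrite !big_ord0 M0.
rewrite !big_ord_recr/=; set A := \big[_/_]_(i < n) _.
have -> : A `|` F n = A `|` (F n `\` A) by rewrite setUDr setDv setD0.
have mA : measurable A := mU n.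
have mD : measurable (F n `\` A) by exact: measurableD.
by rewrite MU ?setDIK// leeD// le_M.
Qed.

(** The infimum of [M]-sums over countable measurable covers. Any countably additive measure below
    [M] is below it by subadditivity, so, being a measure below [M] itself, it is the largest such
    measure. *)
Definition ca_part : set T -> \bar R := mu_ext M.

HB.instance Definition _ := isOuterMeasure.Build R T ca_part
  (mu_ext0 M0 M_ge0) (mu_ext_ge0 M_ge0) (le_mu_ext M)
  (mu_ext_sigma_subadditive M_ge0).

(** Cutting a cover of [X] by [A] and by its complement covers the two parts of [X], and finite
    additivity of [M] preserves the total. No countable additivity is involved. *)
Let caratheodory_ca_part (A : set T) : d.-measurable A -> ca_part.-cara.-measurable A.
Proof.
move=> mA; apply: le_caratheodory_measurable => X.
apply: le_ereal_inf_tmp => _ [F [mF XF] <-].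
apply: (@le_trans _ _ (\sum_(k <oo) M (F k `&` A) + \sum_(k <oo) M (F k `&` ~` A)))%E.
  apply: leeD; apply: ereal_inf_lbound.
  - exists (fun k => F k `&` A) => //; split=> [k|x [Xx Ax]].
      exact: measurableI.
    by have [k _ Fkx] := XF _ Xx; exists k.
  - exists (fun k => F k `&` ~` A) => //; split=> [k|x [Xx Ax]].
      by apply: measurableI => //; exact: measurableC.
    by have [k _ Fkx] := XF _ Xx; exists k.
rewrite -nneseriesD//; apply: lee_nneseries => [k _ _|k _].
  by rewrite adde_ge0.
rewrite -MU; [|exact: measurableI|exact/measurableI/measurableC|].
  by rewrite -setIUr setUCr setIT.
by rewrite setIACA setICr setI0.
Qed.

Let ca_part_additive : semi_sigma_additive ca_part.
Proof.
move=> F mF tF mUF; apply: caratheodory_measure_sigma_additive => //.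
- by move=> i; exact: caratheodory_ca_part.
- exact: caratheodory_ca_part.
Qed.

HB.instance Definition _ := isMeasure.Build _ _ _ ca_part
  (mu_ext0 M0 M_ge0) (mu_ext_ge0 M_ge0) ca_part_additive.

Let ca_part_le B : measurable B -> (ca_part B <= M B)%E.
Proof.
move=> mB; apply: ereal_inf_lbound.
exists (fun k => if k is 0%N then B else set0).
  by split=> [[]//|x Bx]; exists 0%N.
by rewrite (nneseries_split _ 1%N)// big_mkord big_ord1 eseries0 ?adde0// => -[].
Qed.

Let ca_partT : (ca_part setT <= 1)%E.
Proof. exact: le_trans (ca_part_le measurableT) MT. Qed.

HB.instance Definition _ := Measure_isSubProbability.Build _ _ _ ca_part ca_partT.

(* Truncate a nearly optimal countable cover of [B]. *)
Let ca_part_approx (nu : subprobability T R) B (e : R) :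
  measurable B -> 0 < e ->
  exists B', [/\ measurable B', B' `<=` B, (nu (B `\` B') <= e%:E)%E &
                 (M B' <= ca_part B + e%:E)%E].
Proof.
move=> mB e0.
have fB : ca_part B \is a fin_num.
  rewrite ge0_fin_numE; last exact: mu_ext_ge0.
  by rewrite (le_lt_trans (ca_part_le mB))// -ge0_fin_numE// M_fin.
have [_ [F [mF BF] <-] Fe] := lb_ereal_inf_adherent e0 fB.
pose G n := B `&` \big[setU/set0]_(i < n) F i.
have mG n : measurable (G n).
  by apply: measurableI => //; exact: bigsetU_measurable.
have GB : \bigcup_n G n = B.
  apply/seteqP; split=> [x [n _ []]//|x Bx].
  have [k _ Fkx] := BF _ Bx; exists k.+1 => //; split => //.
  by rewrite big_ord_recr/=; right.
have := @nondecreasing_cvg_mu _ _ _ nu G mG.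
rewrite GB => /(_ mB) cG.
have {}cG : nu (G n) @[n --> \oo] --> nu B.
  apply: cG => m n mn; apply/subsetPset; apply: setIS.
  exact: subset_bigsetU.
have fnu C : measurable C -> nu C \is a fin_num by exact: fin_num_measure.
have [n _ Hn] : \forall n \near \oo, (nu B - e%:E < nu (G n))%E.
  apply: (cG [set x | nu B - e%:E < x]%E); apply: open_nbhs_nbhs.
  split; first exact: open_ereal_gt_ereal.
  change (nu B - e%:E < nu B)%E.
  by rewrite lteBlDr// lteDl ?lte_fin// fnu.
exists (G n); split => //.
- exact: subIsetl.
- rewrite measureD//; last by rewrite -ge0_fin_numE ?fnu.
  rewrite setIidr; last exact: subIsetl.
  by rewrite leeBlDl ?fnu// -leeBlDr// ltW// Hn//=.
- apply: le_trans (ltW Fe).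
  apply: le_trans (nneseries_lim_ge n _) => //.
  rewrite big_mkord; apply: le_trans (bigM _ mF).
  by apply: le_M => //; [exact: bigsetU_measurable|exact: subIsetr].
Qed.

(** What [M] has in excess of [Mc] sits, up to [e], on a set that [nu] hardly charges: the remainder
    is purely finitely additive. The quantifier order matters, since [Mc] must serve every posterior
    [nu]. *)
Lemma ca_part_exists : exists Mc : subprobability T R,
  forall (nu : subprobability T R) B (e : R), measurable B -> 0 < e ->
  exists B', [/\ measurable B', B' `<=` B, (nu (B `\` B') <= e%:E)%E &
                 (M B' <= Mc B + e%:E)%E].
Proof. by exists ca_part => nu B e; exact: ca_part_approx. Qed.

End CountablyAdditivePart.

(** * Change of measure *)

Section DonskerVaradhan.
Context {R : realType} {d : measure_display} {T : measurableType d}.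

Definition mpartition K (A : 'I_K -> set T) :=
  [/\ forall k, measurable (A k), trivIset setT A & \bigcup_(k in setT) A k = setT].

Lemma mpartition_sum (mu : subprobability T R) K (A : 'I_K -> set T) :
  mpartition A -> (\sum_k mu (A k) = mu setT)%E.
Proof.
move=> [mA tA <-]; rewrite -measure_bigsetU_ord// -bigcup_seq; congr (mu _).
by apply: eq_bigcupl; split=> k //= _; rewrite mem_index_enum.
Qed.

Lemma integral_partition_ge (mu : subprobability T R) K (A : 'I_K -> set T)
    (a : 'I_K -> R) (f : T -> R) :
  mpartition A -> measurable_fun setT f -> (forall k, 0 <= a k) ->
  (forall x, 0 <= f x) -> (forall k x, A k x -> a k <= f x) ->
  ((\sum_k fine (mu (A k)) * a k)%:E <= \int[mu]_x (f x)%:E)%E.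
Proof.
move=> [mA tA UA] mf a0 f0 af.
rewrite [leLHS](_ : _ = \int[mu]_x (\sum_k (a k)%:E * (\1_(A k) x)%:E))%E.
  apply: ge0_le_integral => //.
  - by move=> x _; apply: sume_ge0 => k _; rewrite mule_ge0// lee_fin.
  - apply: emeasurable_sum => k; apply: measurable_funeM.
    by apply/measurable_EFinP; exact: measurable_indic.
  - exact/measurable_EFinP.
  - move=> x _; have : (\bigcup_(k in setT) A k) x by rewrite UA.
    move=> [k _ Akx]; rewrite (bigD1 k)//= indicE mem_set// mule1.
    rewrite big1 ?adde0 ?lee_fin ?(af _ _ Akx)// => j jk.
    rewrite indicE memNset ?mule0// => Ajx.
    by move/eqP: jk; apply; apply: tA => //; exists x.
rewrite ge0_integral_sum//.
- rewrite -sumEFin; apply: eq_bigr => k _.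
  rewrite ge0_integralZl//; last 2 first.
  + by apply/measurable_EFinP; exact: measurable_indic.
  + by rewrite lee_fin.
  by rewrite integral_indic// setIT EFinM fineK ?fin_num_measure// muleC.
- move=> k; apply: measurable_funeM.
  by apply/measurable_EFinP; exact: measurable_indic.
- by move=> k x _; rewrite mule_ge0// lee_fin.
Qed.

(* Only lower step functions of [expR \o v] are compared with [c], so that the
   lemma also applies when [expR \o v] is dominated by a nonmeasurable function. *)
Lemma donsker_varadhan_step (rho pi : probability T R) (v : T -> R) (b c : R) :
  measurable_fun setT v -> (forall x, `|v x| <= b) -> 0 < c ->
  (forall K (A : 'I_K -> set T) (a : 'I_K -> R), mpartition A ->
    (forall k, 0 <= a k) -> (forall k x, A k x -> a k <= expR (v x)) ->
    \sum_k fine (pi (A k)) * a k <= c) ->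
  (\int[rho]_x (v x)%:E <= KL rho pi + (ln c)%:E)%E.
Proof.
move=> mv vb c0 H; apply/lee_addgt0Pr => e e0.
have [K [A [a [mA tA UA va _]]]] := discretize mv e0 vb.
have pA : mpartition A by [].
apply: le_trans (@integral_partition_le _ _ _ rho K A (fun k => a k + e) v b
  mA tA UA mv vb _) _ => [k x /va/andP[]//|].
have rhoE k : rho (A k) = (fine (rho (A k)))%:E by rewrite fineK// fin_num_measure.
have s1 : \sum_k fine (rho (A k)) = 1.
  apply: EFin_inj; rewrite -sumEFin -(probability_setT rho).
  rewrite -(mpartition_sum rho pA); apply: eq_bigr => k _.
  by rewrite -rhoE.
rewrite [leLHS](_ : _ =
    (\sum_k (fine (rho (A k)) * a k + fine (rho (A k)) * e))%:E).
  rewrite big_split/= -mulr_suml s1 mul1r EFinD leeD2r//.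
  apply: (@KL_partition_ge _ _ _ _ _ K A _ (fun k => fine (pi (A k)))) => //.
  - by move=> k; rewrite fineK// fin_num_measure.
  - by move=> k; exact: fine_ge0.
  - by move=> k; exact: fine_ge0.
  - apply: H => [//|k|k x /va/andP[ax _]]; first exact: expR_ge0.
    by rewrite ler_expR.
by rewrite -sumEFin; apply: eq_bigr => k _; rewrite -mulrDr EFinM -rhoE.
Qed.

Lemma donsker_varadhan (rho pi : probability T R) (v : T -> R) (b c : R) :
  measurable_fun setT v -> (forall x, `|v x| <= b) -> 0 < c ->
  (\int[pi]_x (expR (v x))%:E <= c%:E)%E ->
  (\int[rho]_x (v x)%:E <= KL rho pi + (ln c)%:E)%E.
Proof.
move=> mv vb c0 vc; apply: (@donsker_varadhan_step rho pi v b c) => // K A a pA a0 av.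
rewrite -lee_fin; apply: le_trans vc.
apply: (@integral_partition_ge pi) => //.
exact: measurableT_comp.
Qed.

(** The leftover cell has index [ord0], so that [big_ord_recl] isolates it in sums. *)
Lemma mpartition_cons_rest K (B : 'I_K -> set T) :
  (forall k, measurable (B k)) -> trivIset setT B ->
  mpartition (fun i : 'I_K.+1 =>
    if unlift ord0 i is Some k then B k else ~` \bigcup_(k in setT) B k).
Proof.
move=> mB tB; split.
- move=> k; case: unliftP => [//|_].
  by apply/measurableC/fin_bigcup_measurable => //; exact: finite_finset.
- move=> i j _ _; case: unliftP => [i' ->|->]; case: unliftP => [j' ->|->] //.
  + by move=> /(tB _ _ Logic.I Logic.I) ->.
  + by move=> [x [Bx Nx]]; case: Nx; exists i'.
  + by move=> [x [Nx Bx]]; case: Nx; exists j'.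
- apply/seteqP; split => // x _.
  have [[k _ Bx]|Nx] := pselect ((\bigcup_(k in setT) B k) x).
    by exists (lift ord0 k) => //; rewrite liftK.
  by exists ord0 => //; rewrite unlift_none.
Qed.

End DonskerVaradhan.

(** * Change of measure for a prior kernel that need not be measurable in the algorithm *)

Section NonmeasurablePrior.
Context {R : realType} {dA dY : measure_display}
  {Alg : measurableType dA} {Y : measurableType dY}.
Variables (pi : probability Alg R) (p : Alg -> set Y -> R).
Hypothesis p_ge0 : forall A B, 0 <= p A B.
Hypothesis pT : forall A, p A setT <= 1.
Hypothesis pU : forall A B C, measurable B -> measurable C -> B `&` C = set0 ->
  p A (B `|` C) = p A B + p A C.

Let p_le1 A B : measurable B -> p A B <= 1.
Proof.
move=> mB; apply: le_trans (pT A).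
rewrite -(setvU B) pU ?lerDr//; first exact: measurableC.
by rewrite setICl.
Qed.

Let bounded_p B : measurable B -> bounded_fct (p ^~ B).
Proof. by move=> mB; exists 1 => A; rewrite ger0_norm// p_le1. Qed.

Variable L : (Alg -> R) -> R.
Hypothesis LD : forall X1 X2, bounded_fct X1 -> bounded_fct X2 ->
  L (X1 \+ X2) = L X1 + L X2.
Hypothesis LZ : forall a X, bounded_fct X -> L (fun x => a * X x) = a * L X.
Hypothesis L1 : L (fun=> 1) = 1.
Hypothesis L_ge : forall K (A : 'I_K -> set Alg) (c : 'I_K -> R) X,
  mpartition A -> (forall k x, A k x -> c k <= X x) -> bounded_fct X ->
  \sum_k fine (pi (A k)) * c k <= L X.

Let L_ge0 X : bounded_fct X -> (forall x, 0 <= X x) -> 0 <= L X.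
Proof.
move=> bX X0; have := @L_ge 1 (fun=> setT) (fun=> 0) X.
rewrite big_ord1 mulr0; apply => //; split => //.
- by move=> [[|//] ?] [[|//] ?] _ _ _; exact/val_inj.
- by apply/seteqP; split=> // x _; exists ord0.
Qed.

Let L_sum K (X : 'I_K -> Alg -> R) : (forall k, bounded_fct (X k)) ->
  bounded_fct (fun A => \sum_k X k A) /\
  L (fun A => \sum_k X k A) = \sum_k L (X k).
Proof.
elim: K X => [|K IH] X bX.
  split; first by exists 0 => A; rewrite big_ord0 normr0.
  have -> : (fun A => \sum_k X k A) = (fun=> 0 * 1).
    by apply/funext => A; rewrite big_ord0 mul0r.
  by rewrite LZ ?mul0r ?big_ord0//; exists 1 => A; rewrite normr1.
have [b1 e1] := IH (fun k => X (lift ord0 k)) (fun k => bX _).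
have E : (fun A => \sum_k X k A) =
    X ord0 \+ (fun A => \sum_(k < K) X (lift ord0 k) A).
  by apply/funext => A; rewrite big_ord_recl.
split; first by rewrite E; exact: bounded_fctD.
by rewrite E LD// e1 big_ord_recl.
Qed.

(** The absolute value makes the content nonnegative on every set: for nonmeasurable [B] the
    function [p ^~ B] may be unbounded, and nothing is known about [L] there. On measurable sets it
    changes nothing. *)
Definition mean_content (B : set Y) : \bar R := `|L (p ^~ B)|%:E.

Let mean_contentE B : measurable B -> mean_content B = (L (p ^~ B))%:E.
Proof. by move=> mB; rewrite /mean_content ger0_norm// L_ge0//; exact: bounded_p. Qed.

Lemma mean_content_ge0 B : (0 <= mean_content B)%E.
Proof. by rewrite lee_fin. Qed.

Lemma mean_contentU B C : measurable B -> measurable C -> B `&` C = set0 ->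
  (mean_content (B `|` C) = mean_content B + mean_content C)%E.
Proof.
move=> mB mC BC; rewrite !mean_contentE//; last exact: measurableU.
rewrite -EFinD -LD; [|exact: bounded_p..].
by congr (L _)%:E; apply/funext => A /=; rewrite pU.
Qed.

Lemma mean_contentT : (mean_content setT <= 1)%E.
Proof.
rewrite mean_contentE// lee_fin.
have b1 : bounded_fct (fun=> 1 : R) by exists 1 => A; rewrite normr1.
have bN : bounded_fct (fun A => (-1) * p A setT) by exact/bounded_fctZ/bounded_p.
have : 0 <= L ((fun=> 1) \+ (fun A => (-1) * p A setT)).
  apply: L_ge0; first exact: bounded_fctD.
  by move=> A /=; rewrite mulN1r subr_ge0.
by rewrite LD// L1 LZ ?mulN1r ?subr_ge0//; exact: bounded_p.
Qed.

Variable Mc : subprobability Y R.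
Hypothesis Mc_approx : forall (nu : subprobability Y R) B (e : R),
  measurable B -> 0 < e ->
  exists B', [/\ measurable B', B' `<=` B, (nu (B `\` B') <= e%:E)%E &
                 (mean_content B' <= Mc B + e%:E)%E].

Section change_of_measure.
Variables (rho : probability Alg R) (nu : subprobability Y R)
  (q : Alg -> subprobability Y R) (g : Alg -> \bar R).
Hypothesis qT : forall A, q A setT = 1%E.
Hypothesis mq : forall B, measurable B -> measurable_fun setT (fun A => q A B).
Hypothesis nuE : forall B, measurable B -> nu B = (\int[rho]_A q A B)%E.
Hypothesis mg : measurable_fun setT g.
Hypothesis g_ge0 : forall A, (0 <= g A)%E.
Hypothesis g_ge : forall A K (B : 'I_K -> set Y), mpartition B ->
  (\sum_k klterm (q A (B k)) (p A (B k))%:E <= g A)%E.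

Let qfin A B : measurable B -> q A B = (fine (q A B))%:E.
Proof. by move=> mB; rewrite fineK// fin_num_measure. Qed.

Let q_le1 A B : measurable B -> fine (q A B) <= 1.
Proof.
move=> mB; rewrite -lee_fin -qfin//.
by apply: le_trans (@sprobability_setT _ _ _ (q A)); rewrite le_measure ?inE.
Qed.

(* One step function [u] on [Y]: apply Gibbs' inequality for each algorithm, then
   Donsker-Varadhan over algorithms, truncating at [- t] to keep everything bounded. *)
Lemma change_of_measure_step K (B : 'I_K -> set Y) (u : 'I_K -> R) (t b c : R) :
  mpartition B -> 0 <= t -> (forall k, - t <= u k <= b) -> 0 <= b -> 0 < c ->
  \sum_k L (p ^~ (B k)) * expR (u k) + expR (- t) <= c ->
  (\int[rho]_A g A < +oo)%E ->
  ((\sum_k fine (nu (B k)) * u k)%:E <=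
    KL rho pi + \int[rho]_A g A + (ln c)%:E)%E.
Proof.
move=> pB t0 utb b0 c0 Lc goo.
have mB k : measurable (B k) by case: pB.
(* The summand [expR (- t)] keeps [X] positive, as [gibbs] requires, and gives [ln (X A) >= - t], so
   that the truncation at [- t] below still satisfies [expR (v A) <= X A]. *)
pose X A := \sum_k p A (B k) * expR (u k) + expR (- t).
have X_gt A : expR (- t) <= X A.
  by rewrite /X lerDr sumr_ge0// => k _; rewrite mulr_ge0// expR_ge0.
have bXk k : bounded_fct (fun A => expR (u k) * p A (B k)).
  exact/bounded_fctZ/bounded_p.
have [bs sE] := L_sum bXk.
have bt : bounded_fct (fun _ : Alg => expR (- t) * 1).
  by apply: bounded_fctZ; exists 1 => A; rewrite normr1.
have XE : X = (fun A => \sum_k expR (u k) * p A (B k)) \+ (fun=> expR (- t) * 1).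
  apply/funext => A; rewrite /X /= mulr1; congr (_ + _).
  by apply: eq_bigr => k _; rewrite mulrC.
have bX : bounded_fct X by rewrite XE; exact: bounded_fctD.
have LX : L X <= c.
  apply: le_trans Lc; rewrite XE LD// sE LZ; last by exists 1 => A; rewrite normr1.
  rewrite L1 mulr1 lerD2r ler_sum// => k _.
  by rewrite LZ 1?mulrC//; exact: bounded_p.
pose a A := \sum_k fine (q A (B k)) * u k.
have q1 A : \sum_k fine (q A (B k)) = 1.
  apply: EFin_inj; rewrite -sumEFin -(qT A) -(mpartition_sum (q A) pB).
  by apply: eq_bigr => k _; rewrite -qfin.
have a_itv A : - t <= a A <= b.
  have cE (r : R) : r = \sum_k fine (q A (B k)) * r by rewrite -mulr_suml q1 mul1r.
  rewrite [X in X <= a A]cE [X in _ && (_ <= X)]cE.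
  by apply/andP; split; apply: ler_sum => k _; rewrite ler_wpM2l// ?fine_ge0//;
    case/andP: (utb k).
have ag A : ((a A)%:E <= g A + (ln (X A))%:E)%E.
  have q0 k : 0 <= fine (q A (B k)) by rewrite fine_ge0.
  have X0 : 0 < X A by rewrite (lt_le_trans _ (X_gt A))// expR_gt0.
  apply: le_trans (@gibbs _ K _ (fun k => p A (B k)) u (X A) q0 _ (q1 A) X0 _) _.
  - by move=> k; exact: p_ge0.
  - by rewrite /X lerDl expR_ge0.
  - rewrite leeD2r//; apply: le_trans (g_ge A pB).
    by apply: lee_sum => k _; rewrite -qfin.
have ma : measurable_fun setT a.
  apply: measurable_sum => k; apply: measurable_funM => //.
  by apply: measurableT_comp => //; exact: mq.
(* [g] may be unbounded or even infinite at some algorithms, so [w] has no lower bound; cutting it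
   at [- t] yields the bounded function that Donsker-Varadhan needs. *)
pose w A : \bar R := ((a A)%:E - g A)%E.
have mw : measurable_fun setT w.
  by apply: emeasurable_funB => //; exact/measurable_EFinP.
pose v A := fine (maxe (w A) (- t)%:E).
have mv : measurable_fun setT v.
  apply: measurableT_comp => //; exact: measurable_maxe.
have w_le A : (w A <= (a A)%:E)%E.
  rewrite /w; have := g_ge0 A; case: (g A) => [r| |] //= r0.
    by rewrite -EFinB lee_fin gerBl -lee_fin.
  by rewrite addeNy leNye.
have vE A : (v A)%:E = maxe (w A) (- t)%:E.
  rewrite /v fineK//; case E : (w A) => [r| |].
  - by rewrite -EFin_max.
  - by have := w_le A; rewrite E.
  - by rewrite maxNye.
have v_itv A : - t <= v A <= b.
  rewrite -!lee_fin vE le_max lexx orbT/= ge_max lee_fin.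
  have /andP[h1 h2] := a_itv A.
  by rewrite (le_trans h1 h2) andbT (le_trans (w_le A)).
have vb A : `|v A| <= b + t by rewrite ler_norml; have := v_itv A; lra.
have ev A : expR (v A) <= X A.
  have X0 : 0 < X A by rewrite (lt_le_trans _ (X_gt A))// expR_gt0.
  rewrite -[leRHS]lnK ?posrE// ler_expR -lee_fin vE ge_max; apply/andP; split.
    rewrite /w; have := ag A; have := g_ge0 A.
    case: (g A) => [r| |] //= _; last by rewrite addeNy leNye.
    by rewrite -EFinD -EFinB !lee_fin; lra.
  by rewrite lee_fin -(expRK (- t)) ler_ln ?posrE ?expR_gt0.
(* [X] need not be measurable. Every lower step function of [expR \o v] is also below [X], and
   [L X <= c] bounds its [pi]-sum. *)
have DV : (\int[rho]_A (v A)%:E <= KL rho pi + (ln c)%:E)%E.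
  apply: (@donsker_varadhan_step _ _ _ rho pi v (b + t) c) => // J A h pA h0 hv.
  apply: le_trans LX; apply: L_ge => // k x Akx.
  exact: le_trans (hv _ _ Akx) (ev x).
have ig : rho.-integrable setT g.
  apply/integrableP; split => //.
  by under eq_integral do rewrite gee0_abs//.
have ia : rho.-integrable setT (EFin \o a).
  apply: (@le_integrable _ _ _ rho setT measurableT _ (EFin \o cst (b + t))) => //.
  - exact/measurable_EFinP.
  - move=> A _ /=; rewrite lee_fin (@ger0_norm _ (b + t)) ?addr_ge0//.
    by rewrite ler_norml; have := a_itv A; lra.
  - exact: finite_measure_integrable_cst.
have iv : rho.-integrable setT (EFin \o v).
  apply: (@le_integrable _ _ _ rho setT measurableT _ (EFin \o cst (b + t))) => //.
  - exact/measurable_EFinP.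
  - by move=> A _ /=; rewrite lee_fin (@ger0_norm _ (b + t)) ?addr_ge0.
  - exact: finite_measure_integrable_cst.
have aE : (\int[rho]_A (a A)%:E = (\sum_k fine (nu (B k)) * u k)%:E)%E.
  rewrite /a; under eq_integral do rewrite -sumEFin.
  have iqk k : rho.-integrable setT (fun A => (fine (q A (B k)))%:E).
    apply: (@le_integrable _ _ _ rho setT measurableT _ (EFin \o cst 1)) => //.
    - by apply/measurable_EFinP; apply: measurableT_comp => //; exact: mq.
    - by move=> A _ /=; rewrite lee_fin normr1 ger0_norm ?fine_ge0// q_le1.
    - exact: finite_measure_integrable_cst.
  rewrite integral_sum//; last first.
    move=> k; under eq_fun do rewrite EFinM muleC.
    exact: integrableZl.
  rewrite -sumEFin; apply: eq_bigr => k _.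
  under eq_integral do rewrite EFinM muleC.
  rewrite integralZl// EFinM muleC; congr (_ * _)%E.
  rewrite fineK ?fin_num_measure// nuE//.
  by apply: eq_integral => A _; rewrite -qfin.
have : (\int[rho]_A (a A)%:E - \int[rho]_A g A <= \int[rho]_A (v A)%:E)%E.
  rewrite -integralB//; apply: le_integral => //; first exact: integrableB.
  by move=> A _; rewrite vE le_max /w lexx.
rewrite leeBlDr; last by rewrite ge0_fin_numE// integral_ge0.
rewrite aE => /le_trans; apply.
by rewrite [leRHS]addeAC leeD2r.
Qed.

(** Each cell of a discretisation of [u] is shrunk to a subset on which the content is controlled by
    [Mc]. The pieces removed form [rest], where the content is only known to be at most 1; there [u]
    is replaced by [- t], so that it hardly counts in the exponential sum, while [nu] of [rest] is
    small enough to absorb the factor [t]. *)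
Lemma change_of_measure (u : Y -> R) (b c : R) :
  measurable_fun setT u -> (forall y, `|u y| <= b) -> 0 < c ->
  (\int[Mc]_y (expR (u y))%:E <= c%:E)%E ->
  (\int[nu]_y (u y)%:E <= KL rho pi + \int[rho]_A g A + (ln c)%:E)%E.
Proof.
move=> mu ub c0 uc.
have KL0 : (0 <= KL rho pi)%E.
  by apply: KL_ge0; rewrite ?probability_setT ?lexx ?lee_fin ?ler01.
have g0 : (0 <= \int[rho]_A g A)%E by exact: integral_ge0.
have [->|gfin] := eqVneq (\int[rho]_A g A)%E +oo%E.
  by rewrite addey ?addye ?leey// gt_eqF// (lt_le_trans _ KL0).
have b0 : 0 <= b := le_trans (normr_ge0 _) (ub point).
apply/lee_addgt0Pr => e0 e00.
(* The total error is at most [2 * e + 3 * (e / c)]: discretisation and shrinking cost [e] each, and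
   the logarithm of [c + 2 * e + e] costs the rest. *)
pose e := e0 / (4 + 4 / c).
have den : 0 < 4 + 4 / c by rewrite addr_gt0// divr_gt0.
have e_gt0 : 0 < e by rewrite divr_gt0.
have [K [B [uk [mB tB UB uB ukb]]]] := discretize mu e_gt0 ub.
have pB : mpartition B by [].
(* Then [expR t >= 1 + t >= e^-1], hence [expR (- t) <= e]. *)
pose t := b + e^-1.
have t0 : 0 <= t by rewrite addr_ge0// invr_ge0 ltW.
(* The tolerance per cell, chosen after [K] and [t]. Over the [K] cells, [b] pays for the [nu]-mass
   removed, [t] for the value on [rest], and [expR b] for the excess of the content over [Mc]. *)
pose h := e / (K%:R * (b + t + expR b) + 1).
have D0 : 0 <= b + t + expR b by apply: addr_ge0; [exact: addr_ge0|exact: expR_ge0].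
have den2 : 0 < K%:R * (b + t + expR b) + 1.
  by rewrite ltr_wpDl// mulr_ge0// D0.
have h0 : 0 < h by rewrite divr_gt0.
have Khe : K%:R * h * (b + t + expR b) <= e.
  rewrite [leLHS](_ : _ = e * (K%:R * (b + t + expR b) /
    (K%:R * (b + t + expR b) + 1))); last by rewrite /h; field; rewrite gt_eqF.
  by rewrite ler_piMr ?(ltW e_gt0)// ler_pdivrMr// mul1r lerDl.
have Kh0 : 0 <= K%:R * h by rewrite mulr_ge0// ltW.
have [B' HB'] := choice (fun k => Mc_approx nu (mB k) h0).
have mB' k : measurable (B' k) by case: (HB' k).
have B'B k : B' k `<=` B k by case: (HB' k).
have tB' : trivIset setT B'.
  by move=> i j _ _ [x [Bi Bj]]; apply: tB => //; exists x; split; exact: B'B.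
pose rest := ~` \bigcup_(k in setT) B' k.
have mrest : measurable rest.
  by apply/measurableC/fin_bigcup_measurable => //; exact: finite_finset.
pose B1 := fun i : 'I_K.+1 => if unlift ord0 i is Some k then B' k else rest.
pose u1 := fun i : 'I_K.+1 => if unlift ord0 i is Some k then uk k else - t.
have pB1 : mpartition B1 by exact: mpartition_cons_rest.
have u1_itv k : - t <= u1 k <= b.
  rewrite /u1; case: unliftP => [i _|_].
    have := ukb i; rewrite ler_norml /t => /andP[h1 h2].
    rewrite h2 andbT; apply: le_trans h1.
    by rewrite lerN2 lerDl invr_ge0 ltW.
  by rewrite lexx /t opprD; apply: (@le_trans _ _ 0) => //;
    rewrite -opprD oppr_le0 -/t.
have nufin C : measurable C -> nu C = (fine (nu C))%:E.
  by move=> mC; rewrite fineK// fin_num_measure.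
have Mcfin C : measurable C -> Mc C = (fine (Mc C))%:E.
  by move=> mC; rewrite fineK// fin_num_measure.
have s1 : \sum_k fine (Mc (B k)) * expR (uk k) <= c.
  rewrite -lee_fin; apply: le_trans uc.
  apply: (@integral_partition_ge _ _ _ Mc) => //.
  - exact: measurableT_comp.
  - by move=> k x /uB/andP[ux _]; rewrite ler_expR.
have emt : expR (- t) <= e.
  rewrite expRN -[leRHS]invrK lef_pV2 ?posrE ?expR_gt0 ?invr_gt0//.
  by apply: le_trans (expR_ge1Dx _); rewrite /t addrA lerDr addr_ge0.
(* One [e] for the excess content on the sets [B' k], one for [rest], and one for the extra
   [expR (- t)] of [change_of_measure_step]. *)
have s2 : \sum_k L (p ^~ (B1 k)) * expR (u1 k) + expR (- t) <= c + 2 * e + e.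
  apply: lerD => //; rewrite big_ord_recl /B1 /u1 unlift_none.
  have -> : \sum_(i < K)
     L (p ^~ (if unlift ord0 (lift ord0 i) is Some k then B' k else rest)) *
     expR (if unlift ord0 (lift ord0 i) is Some k then uk k else - t) =
     \sum_(i < K) L (p ^~ (B' i)) * expR (uk i).
    by apply: eq_bigr => i _; rewrite liftK.
  have Lr : L (p ^~ rest) <= 1.
    rewrite -lee_fin -mean_contentE//; apply: le_trans mean_contentT.
    rewrite -(setvU rest) mean_contentU ?setICl//; last exact: measurableC.
    by rewrite leeDr// mean_content_ge0.
  have h1 : L (p ^~ rest) * expR (- t) <= e.
    by apply: le_trans emt; rewrite ler_piMl// expR_ge0.
  have h2 : \sum_(i < K) L (p ^~ (B' i)) * expR (uk i) <=
      \sum_(i < K) (fine (Mc (B i)) * expR (uk i) + h * expR b).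
    apply: ler_sum => i _.
    apply: (@le_trans _ _ ((fine (Mc (B i)) + h) * expR (uk i))).
      rewrite ler_wpM2r ?expR_ge0// -lee_fin EFinD -Mcfin// -mean_contentE//.
      by case: (HB' i).
    rewrite mulrDl lerD2l ler_wpM2l// ?(ltW h0)// ler_expR.
    by have := ukb i; rewrite ler_norml => /andP[].
  rewrite big_split/= sumr_const card_ord -mulr_natl in h2.
  have h3 : K%:R * (h * expR b) <= e.
    apply: le_trans Khe; rewrite mulrA ler_wpM2l//.
    by rewrite lerDr addr_ge0.
  lra.
have c1 : 0 < c + 2 * e + e by rewrite !addr_gt0// mulr_gt0.
have goo : (\int[rho]_A g A < +oo)%E by rewrite lt_neqAle gfin leey.
have step := change_of_measure_step pB1 t0 u1_itv b0 c1 s2 goo.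
have nuB k : fine (nu (B k)) = fine (nu (B' k)) + fine (nu (B k `\` B' k)).
  apply: EFin_inj; rewrite EFinD -!nufin//; last exact: measurableD.
  rewrite -[in LHS](setDUK (B'B k)) measureU//; first exact: measurableD.
  by rewrite setDIK.
have nuD k : 0 <= fine (nu (B k `\` B' k)) <= h.
  rewrite fine_ge0//= -lee_fin -nufin; last exact: measurableD.
  by case: (HB' k).
have nurest : fine (nu rest) <= K%:R * h.
  have : fine (nu rest) + \sum_(k < K) fine (nu (B' k)) = \sum_(k < K) fine (nu (B k)).
    apply: EFin_inj; rewrite EFinD -!sumEFin -nufin//.
    have -> : (\sum_(k < K) (fine (nu (B k)))%:E = nu setT)%E.
      by rewrite -(mpartition_sum nu pB); apply: eq_bigr => k _; rewrite -nufin.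
    rewrite -(mpartition_sum nu pB1) big_ord_recl /B1 unlift_none; congr (_ + _)%E.
    by apply: eq_bigr => k _; rewrite liftK -nufin.
  under [in RHS]eq_bigr do rewrite nuB.
  rewrite big_split/= => E.
  have {E}-> : fine (nu rest) = \sum_(k < K) fine (nu (B k `\` B' k)) by lra.
  apply: (@le_trans _ _ (\sum_(k < K) h)); last by rewrite sumr_const card_ord mulr_natl.
  by apply: ler_sum => k _; case/andP: (nuD k).
have nuT : \sum_k fine (nu (B k)) <= 1.
  rewrite -lee_fin -sumEFin; apply: le_trans (@sprobability_setT _ _ _ nu).
  by rewrite -(mpartition_sum nu pB); apply: lee_sum => k _; rewrite -nufin.
have s3 : \sum_k fine (nu (B k)) * uk k <= \sum_k fine (nu (B1 k)) * u1 k + e.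
  rewrite [X in _ <= X + _]big_ord_recl /B1 /u1 unlift_none.
  have -> : \sum_(i < K)
     fine (nu (if unlift ord0 (lift ord0 i) is Some k then B' k else rest)) *
     (if unlift ord0 (lift ord0 i) is Some k then uk k else - t) =
     \sum_(i < K) fine (nu (B' i)) * uk i.
    by apply: eq_bigr => i _; rewrite liftK.
  under eq_bigr do rewrite nuB mulrDl.
  rewrite big_split/=.
  have : \sum_(k < K) fine (nu (B k `\` B' k)) * uk k <= K%:R * h * b.
    apply: (@le_trans _ _ (\sum_(k < K) h * b)); last first.
      by rewrite sumr_const card_ord -(mulr_natl (h * b)) mulrA.
    apply: ler_sum => k _; have /andP[n0 nh] := nuD k.
    apply: (@le_trans _ _ (fine (nu (B k `\` B' k)) * b)).
      by rewrite ler_wpM2l//; have := ukb k; rewrite ler_norml => /andP[].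
    by rewrite ler_wpM2r.
  have : fine (nu rest) * t <= K%:R * h * t by rewrite ler_wpM2r.
  have : 0 <= K%:R * h * expR b by rewrite mulr_ge0// expR_ge0.
  have := Khe; rewrite 2![K%:R * h * (_ + _)]mulrDr mulrN.
  move: (K%:R * h * b) (K%:R * h * t) (K%:R * h * expR b) (fine (nu rest) * t).
  by move=> *; lra.
have lnc : ln (c + 2 * e + e) <= ln c + 3 * (e / c).
  have -> : c + 2 * e + e = c * (1 + 3 * (e / c)) by field; rewrite gt_eqF.
  have ec0 : 0 <= 3 * (e / c) by apply: mulr_ge0 => //; apply: divr_ge0; exact: ltW.
  rewrite lnM ?posrE//; last by rewrite ltr_wpDr.
  by rewrite lerD2l le_ln1Dx// (lt_le_trans _ ec0)// ltrN10.
apply: le_trans (@integral_partition_le _ _ _ nu K B (fun k => uk k + e) u b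
  mB tB UB mu ub _) _ => [k x /uB/andP[]//|].
apply: (@le_trans _ _ ((\sum_k fine (nu (B k)) * uk k) + e)%:E).
  under eq_bigr do rewrite nufin// -EFinM mulrDr.
  rewrite sumEFin lee_fin big_split/= lerD2l -mulr_suml.
  by rewrite ler_piMl// ltW.
apply: (@le_trans _ _ (((\sum_k fine (nu (B1 k)) * u1 k)%:E + (2 * e)%:E)))%E.
  by rewrite -EFinD lee_fin; lra.
apply: (@le_trans _ _ (KL rho pi + \int[rho]_A g A + (ln (c + 2 * e + e))%:E +
  (2 * e)%:E)%E); first by rewrite leeD2r.
rewrite -[leLHS]addeA -[leRHS]addeA leeD2l// -!EFinD lee_fin.
have -> : e0 = 4 * e + 4 * (e / c) by rewrite /e; field; rewrite !gt_eqF//=; lra.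
have : 0 <= e / c by apply: divr_ge0; exact: ltW.
move: lnc; move: (ln (c + 2 * e + e)) (e / c) (ln c) => *; lra.
Qed.

End change_of_measure.
End NonmeasurablePrior.

(* The prior kernel [p] is not assumed measurable in the algorithm, so the mixture
   [\int[pi]_A p A] may not exist.  Its role is played by the countably additive
   part of the content obtained from a finitely additive extension of [pi]. *)
Lemma nonmeasurable_mixture (R : realType) (dA dY : measure_display)
    (Alg : measurableType dA) (Y : measurableType dY)
    (pi : probability Alg R) (p : Alg -> set Y -> R) :
  (forall A B, 0 <= p A B) -> (forall A, p A setT <= 1) ->
  (forall A B C, measurable B -> measurable C -> B `&` C = set0 ->
    p A (B `|` C) = p A B + p A C) ->
  exists Mc : subprobability Y R,
  forall (rho : probability Alg R) (nu : subprobability Y R)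
    (q : Alg -> subprobability Y R) (g : Alg -> \bar R),
  (forall A, q A setT = 1%E) ->
  (forall B, measurable B -> measurable_fun setT (fun A => q A B)) ->
  (forall B, measurable B -> nu B = (\int[rho]_A q A B)%E) ->
  measurable_fun setT g -> (forall A, (0 <= g A)%E) ->
  (forall A K (B : 'I_K -> set Y), mpartition B ->
    (\sum_k klterm (q A (B k)) (p A (B k))%:E <= g A)%E) ->
  forall (u : Y -> R) (b c : R),
  measurable_fun setT u -> (forall y, `|u y| <= b) -> 0 < c ->
  (\int[Mc]_y (expR (u y))%:E <= c%:E)%E ->
  (\int[nu]_y (u y)%:E <= KL rho pi + \int[rho]_A g A + (ln c)%:E)%E.
Proof.
move=> p0 pT pU; have [L [LD LZ L1 Lge]] := mean_exists pi.
have L_ge : forall K (A : 'I_K -> set Alg) (c : 'I_K -> R) X,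
    mpartition A -> (forall k x, A k x -> c k <= X x) -> bounded_fct X ->
    \sum_k fine (pi (A k)) * c k <= L X.
  by move=> K A c X [mA tA UA] AX bX; exact: Lge.
have [Mc HMc] := ca_part_exists (mean_content_ge0 p L)
  (mean_contentT p0 pT pU LD LZ L1 L_ge) (mean_contentU p0 pT pU LD L_ge).
exists Mc => rho nu q g qT mq nuE mg g0 gge u b c mu ub c0 uc.
exact: (change_of_measure p0 pT pU LD LZ L1 L_ge HMc qT mq nuE mg g0 gge mu ub c0 uc).
Qed.

(** * Product measures in the Giry monad *)

Section GiryTuple.
Context {R : realType}.

Lemma integral_cst1 d (T : measurableType d) (mu : giry T R) (c : \bar R) :
  mu setT = 1%E -> (\int[mu]_x c = c)%E.
Proof.
move=> m1; rewrite integral_cst// -[RHS]mule1; congr (_ * _)%E; exact: m1.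
Qed.

Section param.
Context {dX d : measure_display} {X : measurableType dX} {T : measurableType d}.

(** The integral equals that of [g] against the product of the Dirac mass at [x] with [f x], and
    Dirac, product and integration are measurable operations on [giry]. *)
Lemma measurable_giry_int_param (f : X -> giry T R) (g : X * T -> \bar R) :
  measurable_fun setT f -> measurable_fun setT g -> (forall x, (0 <= g x)%E) ->
  measurable_fun setT (fun x => \int[f x]_t g (x, t))%E.
Proof.
move=> mf mg g0.
have -> : (fun x => \int[f x]_t g (x, t))%E =
    (giry_int ^~ g) \o (@giry_prod _ _ X T R) \o (fun x => (giry_ret x, f x)).
  apply/funext => x /=; rewrite giry_int_prod1// giry_int_ret//.
  exact: (measurable_fun_fubini_tonelli_F (m2 := f x)).
apply: measurableT_comp; last first.
  by apply/measurable_fun_pair => //; exact: measurable_giry_ret.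
apply: measurableT_comp; last exact: measurable_giry_prod.
exact: measurable_giry_int.
Qed.

End param.

Context {d : measure_display} {T : measurableType d}.

Definition tuple_cons k (x : T * k.-tuple T) : k.+1.-tuple T := [tuple of x.1 :: x.2].

Lemma measurable_tuple_cons k : measurable_fun setT (@tuple_cons k).
Proof. exact: measurable_cons. Qed.

(** The recursion of [tupleIntF], now producing a point of [giry], so that measurable dependence on
    the factors follows from that of the Giry operations. *)
Fixpoint tuple_giry k : ('I_k -> giry T R) -> giry (k.-tuple T) R :=
  match k return ('I_k -> giry T R) -> giry (k.-tuple T) R with
  | 0 => fun _ => giry_ret [tuple]
  | k'.+1 => fun mus => giry_map (@measurable_tuple_cons k')
      (giry_prod (mus ord0, tuple_giry (fun j => mus (lift ord0 j))))
  end.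

Lemma integral_tuple_giryS k (mus : 'I_k.+1 -> giry T R)
    (g : k.+1.-tuple T -> \bar R) :
  measurable_fun setT g -> (forall t, (0 <= g t)%E) ->
  (\int[tuple_giry mus]_t g t =
   \int[mus ord0]_x \int[tuple_giry (fun j => mus (lift ord0 j))]_t
     g [tuple of x :: t])%E.
Proof.
move=> mg g0 /=.
have := giry_int_map (@measurable_tuple_cons k)
  (giry_prod (mus ord0, tuple_giry (fun j => mus (lift ord0 j)))) mg g0.
rewrite [X in X = _ -> _]/giry_int => ->; rewrite giry_int_prod1//.
  by apply: measurableT_comp => //; exact: measurable_tuple_cons.
by move=> x; exact: g0.
Qed.

Lemma measurable_cons_section k (g : k.+1.-tuple T -> \bar R) x :
  measurable_fun setT g ->
  measurable_fun setT (fun t : k.-tuple T => g [tuple of x :: t]).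
Proof. by move=> mg; apply: measurableT_comp => //; exact: measurable_cons. Qed.

Lemma tupleIntF_giry k (mus : 'I_k -> giry T R) (g : k.-tuple T -> \bar R) :
  measurable_fun setT g -> (forall t, (0 <= g t)%E) ->
  tupleIntF (fun i => mus i : {measure set T -> \bar R}) g =
  (\int[tuple_giry mus]_t g t)%E.
Proof.
elim: k mus g => [|k IH] mus g mg g0.
  by rewrite /= integral_dirac// diracT mul1e.
rewrite integral_tuple_giryS//=; apply: eq_integral => x _.
by rewrite IH//; exact: measurable_cons_section.
Qed.

Lemma iterFun_giry (I : (T -> \bar R) -> \bar R) (mu : giry T R) :
  (forall g, measurable_fun setT g -> (forall t, (0 <= g t)%E) ->
    I g = (\int[mu]_t g t)%E) ->
  forall k (g : k.-tuple T -> \bar R),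
  measurable_fun setT g -> (forall t, (0 <= g t)%E) ->
  iterFun I g = (\int[tuple_giry (fun _ : 'I_k => mu)]_t g t)%E.
Proof.
move=> IE; elim=> [|k IH] g mg g0.
  by rewrite /= integral_dirac// diracT mul1e.
rewrite integral_tuple_giryS//=.
have E : (fun x => iterFun I (fun t : k.-tuple T => g [tuple of x :: t])) =
   (fun x => \int[tuple_giry (fun _ : 'I_k => mu)]_t g [tuple of x :: t])%E.
  by apply/funext => x; rewrite IH//; exact: measurable_cons_section.
rewrite E IE// => [|x]; last exact: integral_ge0.
apply: (measurable_giry_int_param
  (g := fun y : T * k.-tuple T => g [tuple of y.1 :: y.2])) => //.
by apply: measurableT_comp => //; exact: measurable_tuple_cons.
Qed.

Lemma measurable_tuple_giry {dX} {X : measurableType dX} k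
    (f : X -> 'I_k -> giry T R) :
  (forall i, measurable_fun setT (f ^~ i)) ->
  measurable_fun setT (fun x => tuple_giry (f x)).
Proof.
elim: k f => [|k IH] f mf /=; first exact: measurable_cst.
apply: (measurableT_comp (measurable_giry_map (@measurable_tuple_cons k))).
apply: (measurableT_comp measurable_giry_prod).
by apply/measurable_fun_pair => //; apply: IH => i; exact: mf.
Qed.

Lemma tuple_giryT k (mus : 'I_k -> giry T R) :
  (forall i, mus i setT = 1%E) -> tuple_giry mus setT = 1%E.
Proof.
elim: k mus => [|k IH] mus m1; first by rewrite /= diracT.
rewrite -[LHS]mul1e -[LHS]integral_cst// integral_tuple_giryS//.
under eq_integral do rewrite integral_cst1 ?IH//.
by rewrite integral_cst1.
Qed.

(** Integrating out the other coordinates multiplies by their masses, which are at most 1. *)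
Lemma integral_tuple_giry_tnth_le k (mus : 'I_k -> giry T R) i (g : T -> \bar R) :
  measurable_fun setT g -> (forall t, (0 <= g t)%E) ->
  (\int[tuple_giry mus]_t g (tnth t i) <= \int[mus i]_x g x)%E.
Proof.
move=> mg g0; elim: k mus i => [mus []//|k IH] mus i.
have mgt j : measurable_fun setT (fun t : k.+1.-tuple T => g (tnth t j)).
  by apply: measurableT_comp => //; exact: measurable_tnth.
rewrite integral_tuple_giryS//.
case: (unliftP ord0 i) => [j ->|->].
  under eq_integral do under eq_integral do rewrite tnthS.
  rewrite integral_cst//.
  apply: le_trans (IH (fun j => mus (lift ord0 j)) j).
  by rewrite -[leRHS]mule1 lee_wpmul2l ?sprobability_setT// integral_ge0.
under eq_integral do under eq_integral do rewrite tnth0.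
apply: ge0_le_integral => //.
- by move=> x _; exact: integral_ge0.
- under eq_fun do rewrite integral_cst//.
  exact: emeasurable_funM.
- move=> x _; rewrite integral_cst//.
  by rewrite -[leRHS]mule1 lee_wpmul2l ?sprobability_setT.
Qed.

Lemma integral_tuple_giry_tnth k (mus : 'I_k -> giry T R) i (g : T -> \bar R) :
  (forall i, mus i setT = 1%E) ->
  measurable_fun setT g -> (forall t, (0 <= g t)%E) ->
  (\int[tuple_giry mus]_t g (tnth t i) = \int[mus i]_x g x)%E.
Proof.
move=> + mg g0; elim: k mus i => [mus []//|k IH] mus i m1.
have mgt j : measurable_fun setT (fun t : k.+1.-tuple T => g (tnth t j)).
  by apply: measurableT_comp => //; exact: measurable_tnth.
rewrite integral_tuple_giryS//.
case: (unliftP ord0 i) => [j ->|->].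
  under eq_integral do under eq_integral do rewrite tnthS.
  by rewrite integral_cst1// IH.
apply: eq_integral => x _.
under eq_integral do rewrite tnth0.
by rewrite integral_cst1// tuple_giryT.
Qed.

(** Independence: the factor of the first coordinate leaves the inner integral, which is at most 1
    by induction. *)
Lemma integral_tuple_giry_prod_le1 k (mus : 'I_k -> giry T R)
    (phi : 'I_k -> T -> R) :
  (forall i, measurable_fun setT (phi i)) -> (forall i x, 0 <= phi i x) ->
  (forall i, (\int[mus i]_x (phi i x)%:E <= 1)%E) ->
  (\int[tuple_giry mus]_t (\prod_i phi i (tnth t i))%:E <= 1)%E.
Proof.
elim: k mus phi => [|k IH] mus phi mphi phi0 phi1.
  under eq_integral do rewrite big_ord0.
  by rewrite integral_cst1// tuple_giryT// => -[].
have mprod j (psi : 'I_j -> T -> R) : (forall i, measurable_fun setT (psi i)) ->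
    measurable_fun setT (fun t : j.-tuple T => (\prod_i psi i (tnth t i))%:E).
  move=> mpsi; apply/measurable_EFinP; apply: measurable_prod => i _.
  by apply: measurableT_comp => //; exact: measurable_tnth.
have p0 j (psi : 'I_j -> T -> R) t : (forall i x, 0 <= psi i x) ->
    0 <= \prod_i psi i (tnth t i) by move=> psi0; exact: prodr_ge0.
rewrite integral_tuple_giryS//; last 2 first.
- exact: mprod.
- by move=> t; rewrite lee_fin p0.
under eq_integral => x _.
  under eq_integral => t _.
    rewrite big_ord_recl tnth0 EFinM.
    under eq_bigr do rewrite tnthS.
    over.
  rewrite ge0_integralZl//; last 3 first.
  - exact: (mprod _ (fun i => phi (lift ord0 i))).
  - by move=> t _; rewrite lee_fin; exact: (p0 _ (fun i => phi (lift ord0 i))).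
  - by rewrite lee_fin.
  over.
apply: le_trans (phi1 ord0); apply: ge0_le_integral => //.
- move=> x _; rewrite mule_ge0 ?lee_fin// integral_ge0// => t _.
  by rewrite lee_fin; exact: (p0 _ (fun i => phi (lift ord0 i))).
- under eq_fun do rewrite muleC.
  by apply: measurable_funeM; exact/measurable_EFinP.
- exact/measurable_EFinP.
- move=> x _; rewrite -[leRHS]mule1 lee_wpmul2l ?lee_fin//.
  exact: (IH _ (fun i => phi (lift ord0 i))).
Qed.

Lemma tupleInt_cst (mu : {measure set T -> \bar R}) k (c : \bar R) :
  mu setT = 1%E -> (0 <= c)%E -> tupleInt mu (fun _ : k.-tuple T => c) = c.
Proof.
move=> m1 c0; rewrite /tupleInt; elim: k => [//|k IH] /=.
by under eq_integral do rewrite IH; rewrite integral_cst ?m1 ?mule1.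
Qed.

(** The trailing coordinates integrate to 1, so the first [m] of [k] draws are distributed as [m]
    draws. This reconciles datasets cut from [mmax] draws with the [m] draws in [metaRisk]. *)
Lemma tupleInt_take (mu : {measure set T -> \bar R}) m k (g : seq T -> \bar R) :
  mu setT = 1%E -> (forall s, (0 <= g s)%E) -> (m <= k)%N ->
  tupleInt mu (fun t : k.-tuple T => g (take m t)) =
  tupleInt mu (fun t : m.-tuple T => g t).
Proof.
move=> m1; elim: m k g => [|m IH] k g g0 mk.
  rewrite [RHS]/tupleInt/= -[RHS](@tupleInt_cst mu k)//; congr (tupleInt _ _).
  by apply/funext => t; rewrite take0.
case: k mk => // k mk; rewrite /tupleInt /=; apply: eq_integral => x _.
exact: (IH k (fun s => g (x :: s))).
Qed.

End GiryTuple.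

(** * Exponential moments *)

Section BoundedExpectation.
Context {R : realType}.

(** Bounded measurable functions are integrable against every element of [giry], which allows
    real-valued integral calculus throughout. *)
Definition bmf {d} {T : measurableType d} (f : T -> R) :=
  measurable_fun setT f /\ bounded_fct f.

Section bmf.
Context {d : measure_display} {T : measurableType d}.
Implicit Types (f g : T -> R) (mu : giry T R).

Lemma bmf_cst c : bmf (fun _ : T => c).
Proof. by split; [exact: measurable_cst|exists `|c|]. Qed.

Lemma bmfD f g : bmf f -> bmf g -> bmf (fun x => f x + g x).
Proof. by move=> [mf bf] [mg bg]; split; [exact: measurable_funD|exact: bounded_fctD]. Qed.

Lemma bmfZ a f : bmf f -> bmf (fun x => a * f x).
Proof. by move=> [mf bf]; split; [exact: measurable_funM|exact: bounded_fctZ]. Qed.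

Lemma bmf_sum I (s : seq I) (F : I -> T -> R) : (forall i, bmf (F i)) ->
  bmf (fun x => \sum_(i <- s) F i x).
Proof.
move=> bF; elim: s => [|i s IH].
  by under eq_fun do rewrite big_nil; exact: bmf_cst.
by under eq_fun do rewrite big_cons; exact: bmfD.
Qed.

Lemma bmf_itv f a b : measurable_fun setT f -> (forall x, a <= f x <= b) -> bmf f.
Proof.
move=> mf fab; split=> //; exists (`|a| + `|b|) => x.
have := fab x; have := ler_norm b; have := lerNnormlW (lexx `|a|).
have := normr_ge0 a; have := normr_ge0 b.
by rewrite ler_norml; lra.
Qed.

Lemma bmf_integrable mu f : bmf f -> mu.-integrable setT (EFin \o f).
Proof.
move=> [mf [b fb]].
apply: (@le_integrable _ _ _ mu setT measurableT _ (EFin \o cst b)) => //.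
- exact/measurable_EFinP.
- by move=> x _ /=; rewrite lee_fin (le_trans (fb x))// ler_norm.
- exact: finite_measure_integrable_cst.
Qed.

Lemma EFin_Rintegral mu f : bmf f ->
  ((\int[mu]_x f x)%R)%:E = (\int[mu]_x (f x)%:E)%E.
Proof.
move=> bf; rewrite /Rintegral fineK//.
exact: (integrable_fin_num measurableT (bmf_integrable mu bf)).
Qed.

Lemma bmf_RintegralD mu f g : bmf f -> bmf g ->
  (\int[mu]_x (f x + g x) = \int[mu]_x f x + \int[mu]_x g x)%R.
Proof. by move=> bf bg; rewrite RintegralD//; exact: bmf_integrable. Qed.

Lemma bmf_RintegralZ mu a f : bmf f ->
  (\int[mu]_x (a * f x) = a * \int[mu]_x f x)%R.
Proof. by move=> bf; rewrite RintegralZl//; exact: bmf_integrable. Qed.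

Lemma bmf_Rintegral_cst mu c : mu setT = 1%E -> (\int[mu]_x c = c)%R.
Proof. by move=> m1; rewrite /Rintegral integral_cst1. Qed.

Lemma bmf_Rintegral_sum mu I (s : seq I) (F : I -> T -> R) : (forall i, bmf (F i)) ->
  (\int[mu]_x (\sum_(i <- s) F i x) = \sum_(i <- s) \int[mu]_x F i x)%R.
Proof.
move=> bF; elim: s => [|i s IH].
  rewrite big_nil; under eq_Rintegral do rewrite big_nil.
  by rewrite /Rintegral integral0.
rewrite big_cons -IH -bmf_RintegralD//; last exact: bmf_sum.
by apply: eq_Rintegral => x _; rewrite big_cons.
Qed.

Lemma le_bmf_Rintegral mu f g : bmf f -> bmf g -> (forall x, f x <= g x) ->
  (\int[mu]_x f x <= \int[mu]_x g x)%R.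
Proof.
move=> bf bg fg; rewrite -lee_fin !EFin_Rintegral//.
apply: le_integral => //; [exact: bmf_integrable..|].
by move=> x _; rewrite lee_fin.
Qed.

Lemma bmf_Rintegral_itv mu f : bmf f -> (forall x, 0 <= f x <= 1) ->
  0 <= (\int[mu]_x f x)%R <= 1.
Proof.
move=> bf f01; rewrite -!lee_fin EFin_Rintegral// integral_ge0/=; last first.
  by move=> x _; rewrite lee_fin; case/andP: (f01 x).
apply: le_trans (@sprobability_setT _ _ _ mu).
rewrite -[leRHS]mul1e -[leRHS]integral_cst//.
apply: ge0_le_integral => //.
- by move=> x _; rewrite lee_fin; case/andP: (f01 x).
- by apply/measurable_EFinP; case: bf.
- by move=> x _; rewrite lee_fin; case/andP: (f01 x).
Qed.

End bmf.

(** The hypothesis on nonnegative functions is applied to [f + b]; both masses are 1, so the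
    constant cancels. *)
Lemma bmf_Rintegral_comp d d' (T : measurableType d) (T' : measurableType d')
    (h : T' -> T) (mu' : giry T' R) (mu : giry T R) (f : T -> R) :
  measurable_fun setT h -> mu' setT = 1%E -> mu setT = 1%E ->
  (forall g : T -> \bar R, measurable_fun setT g -> (forall x, (0 <= g x)%E) ->
    \int[mu']_x g (h x) = \int[mu]_x g x)%E ->
  bmf f -> (\int[mu']_x f (h x) = \int[mu]_x f x)%R.
Proof.
move=> mh m1' m1 H bf; have [mf [b fb]] := bf.
have bfh : bmf (f \o h).
  by split; [exact: measurableT_comp|exists b => x; exact: fb].
have E := H (fun x => (f x + b)%:E).
have : (\int[mu']_x (f (h x) + b) = \int[mu]_x (f x + b))%R.
  rewrite /Rintegral E// => [|x].
    by apply/measurable_EFinP; exact: measurable_funD.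
  by rewrite lee_fin; have := fb x; rewrite ler_norml; lra.
rewrite !bmf_RintegralD//; try exact: bmf_cst.
by rewrite !bmf_Rintegral_cst//; lra.
Qed.

(** The Laplace transform at [c] of a Bernoulli variable of mean [p], which is the argument of [ln]
    in the Catoni inverses. *)
Definition mix (c p : R) : R := 1 - p + p * expR (- c).

Lemma mix_itv c p : 0 <= c -> 0 <= p <= 1 -> expR (- c) <= mix c p <= 1.
Proof.
move=> c0 p01; rewrite /mix.
have : expR (- c) <= 1 by rewrite expR_le1 oppr_le0.
move: (expR (- c)) => e; nra.
Qed.

Lemma mix_gt0 c p : 0 <= c -> 0 <= p <= 1 -> 0 < mix c p.
Proof.
move=> c0 p01; have /andP[h _] := mix_itv c0 p01.
by rewrite (lt_le_trans _ h)// expR_gt0.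
Qed.

Lemma ln_mix_itv c p : 0 <= c -> 0 <= p <= 1 -> - c <= ln (mix c p) <= 0.
Proof.
move=> c0 p01; have /andP[h1 h2] := mix_itv c0 p01.
by rewrite ln_le0// andbT -[- c]expRK ler_ln ?posrE ?mix_gt0// expR_gt0.
Qed.

(* Convexity of [exp], from its tangent line at [- c * p]. *)
Lemma expR_le_mix c p : 0 <= p <= 1 -> expR (- c * p) <= mix c p.
Proof.
move=> p01.
have h1 := expR_ge1Dx (c * p); have h2 := expR_ge1Dx (- c + c * p).
have e0 : 0 < expR (- c * p) by exact: expR_gt0.
have {}h1 : expR (- c * p) * (1 + c * p) <= 1.
  apply: le_trans (ler_wpM2l (ltW e0) h1) _.
  by rewrite -expRD mulNr addNr expR0.
have {}h2 : expR (- c * p) * (1 + (- c + c * p)) <= expR (- c).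
  apply: le_trans (ler_wpM2l (ltW e0) h2) _.
  by rewrite -expRD addrCA mulNr addNr addr0.
rewrite /mix; move: (expR (- c * p)) (expR (- c)) e0 h1 h2 => e f e0 h1 h2; nra.
Qed.

Lemma measurable_mix d (T : measurableType d) (c p : T -> R) :
  measurable_fun setT c -> measurable_fun setT p ->
  measurable_fun setT (fun x => mix (c x) (p x)).
Proof.
move=> mc mp; apply: measurable_funD; first exact: measurable_funB.
apply: measurable_funM => //; apply: measurableT_comp => //.
exact: measurableT_comp.
Qed.

Lemma measurable_ln_mix d (T : measurableType d) (c p : T -> R) :
  measurable_fun setT c -> measurable_fun setT p ->
  measurable_fun setT (fun x => ln (mix (c x) (p x))).
Proof.
by move=> mc mp; apply: measurableT_comp => //; exact: measurable_mix.
Qed.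

Section mix.
Context {d : measure_display} {T : measurableType d}.
Variables (mu : giry T R) (c : R) (r : T -> R).
Hypotheses (c0 : 0 <= c) (mr : measurable_fun setT r) (r01 : forall x, 0 <= r x <= 1).

Let br : bmf r. Proof. exact: bmf_itv r01. Qed.

(** By convexity [expR (- c * r x) <= mix c (r x)]. As [mix c] is affine, its integral is at most
    [mix c] of the mean; the inequality accounts for [mu] having mass at most 1. Dividing by the
    latter gives 1. *)
Lemma exp_moment_le1 :
  (\int[mu]_x (expR (- c * r x - ln (mix c (\int[mu]_y r y)%R)))%:E <= 1)%E.
Proof.
set rho := (\int[mu]_y r y)%R.
have rho01 : 0 <= rho <= 1 by exact: bmf_Rintegral_itv.
have m0 := mix_gt0 c0 rho01.
have bm : bmf (fun x => mix c (r x)).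
  by apply: (@bmf_itv _ _ _ (expR (- c)) 1); [exact: measurable_mix|move=> x; exact: mix_itv].
have mE : (\int[mu]_x mix c (r x) <= mix c rho)%R.
  rewrite /mix; under eq_Rintegral do rewrite -addrA -mulN1r [X in _ + (_ + X)]mulrC -mulrDl.
  rewrite bmf_RintegralD ?bmf_RintegralZ//; [|exact: bmf_cst|exact: bmfZ].
  rewrite -/rho mulrDl mulN1r [expR _ * _]mulrC addrA !lerD2r.
  have [|_ //] := andP (@bmf_Rintegral_itv _ _ mu (fun=> 1) (bmf_cst 1) _).
  by move=> x; rewrite ler01 lexx.
apply: (@le_trans _ _ (\int[mu]_x ((mix c rho)^-1 * mix c (r x))%:E)%E).
  apply: ge0_le_integral => //.
  - apply/measurable_EFinP; apply: measurableT_comp => //.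
    by apply: measurable_funB => //; exact: measurable_funM.
  - by apply/measurable_EFinP; case: (bmfZ (mix c rho)^-1 bm).
  - move=> x _; rewrite lee_fin expRD expRN lnK ?posrE// mulrC.
    by rewrite ler_wpM2l ?invr_ge0 ?(ltW m0)// expR_le_mix.
rewrite -EFin_Rintegral; last exact: bmfZ.
by rewrite lee_fin bmf_RintegralZ// mulrC ler_pdivrMr// mul1r.
Qed.

Lemma bmf_ln_mix : bmf (fun x => ln (mix c (r x))).
Proof.
apply: (@bmf_itv _ _ _ (- c) 0); first exact: measurable_ln_mix.
by move=> x; exact: ln_mix_itv.
Qed.

(* Jensen's inequality for [ln], by integrating the tangent line at the mean. *)
Lemma jensen_ln_mix : mu setT = 1%E ->
  (\int[mu]_x ln (mix c (r x)) <= ln (mix c (\int[mu]_y r y)))%R.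
Proof.
move=> m1; set rho := (\int[mu]_y r y)%R.
have rho01 : 0 <= rho <= 1 by exact: bmf_Rintegral_itv.
have m0 := mix_gt0 c0 rho01.
(* The slope of [p |-> ln (mix c p)] at the mean. *)
pose s := (expR (- c) - 1) / mix c rho.
apply: (@le_trans _ _ (\int[mu]_x ((ln (mix c rho) - s * rho) + s * r x))%R).
  apply: le_bmf_Rintegral; first exact: bmf_ln_mix.
    by apply: bmfD; [exact: bmf_cst|exact: bmfZ].
  move=> x; have mx0 := mix_gt0 c0 (r01 x).
  have h := expR_ge1Dx (ln (mix c (r x)) - ln (mix c rho)).
  rewrite expRD expRN !lnK ?posrE// in h.
  have E : mix c (r x) / mix c rho = 1 + s * (r x - rho).
    by rewrite /s /mix; field; rewrite gt_eqF.
  rewrite E in h; lra.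
rewrite bmf_RintegralD ?bmf_RintegralZ ?bmf_Rintegral_cst//; [|exact: bmf_cst|exact: bmfZ].
by rewrite -/rho subrK.
Qed.

End mix.
End BoundedExpectation.

(** * Markov's inequality and exponential moments averaged over a prior *)

Section MomentBounds.
Context {R : realType}.

Lemma markov_le1 d (T : measurableType d) (mu : giry T R) (X : T -> \bar R) (a : R) :
  measurable_fun setT X -> (forall t, (0 <= X t)%E) -> 0 < a ->
  (\int[mu]_t X t <= 1)%E ->
  measurable [set t | (X t <= a%:E)%E] /\
  (mu (~` [set t | (X t <= a%:E)%E]) <= (a^-1)%:E)%E.
Proof.
move=> mX X0 a0 X1.
have mS : measurable [set t | (X t <= a%:E)%E].
  by rewrite -[X in measurable X]setTI; exact: emeasurable_fun_infty_c.
split => //; set S := ~` _; have mSc : measurable S by exact: measurableC.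
rewrite -(@lee_pmul2l _ a%:E)// -EFinM divff ?gt_eqF//.
apply: le_trans X1; rewrite -[S]setIT -integral_indic// -ge0_integralZl//; last first.
  by rewrite lee_fin ltW.
  by apply/measurable_EFinP; exact: measurable_indic.
apply: ge0_le_integral => //.
- by move=> t _; rewrite mule_ge0// lee_fin ltW.
- by apply: measurable_funeM; apply/measurable_EFinP; exact: measurable_indic.
- move=> t _; rewrite indicE; have [St|nSt] := boolP (t \in S).
    by rewrite mule1; move: St; rewrite inE /S /= => /negP; rewrite -ltNge => /ltW.
  by rewrite mule0.
Qed.

Context {dV dY : measure_display} {V : measurableType dV} {Y : measurableType dY}.

(** Tonelli moves the sample integral inside, where independence bounds it by 1 for each fixed [y].
    It is here that the prior [nu] has to be countably additive. *)
Lemma prior_moment_le1 (mu : giry V R) (nu : giry Y R) n (phi : 'I_n -> Y -> V -> R) :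
  (forall i, measurable_fun setT (fun x : Y * V => phi i x.1 x.2)) ->
  (forall i y v, 0 <= phi i y v) ->
  (forall i y, (\int[mu]_v (phi i y v)%:E <= 1)%E) ->
  let X := fun ws : n.-tuple V => (\int[nu]_y (\prod_i phi i y (tnth ws i))%:E)%E in
  [/\ measurable_fun setT X, forall ws, (0 <= X ws)%E &
      (\int[tuple_giry (fun _ : 'I_n => mu)]_ws X ws <= 1)%E].
Proof.
move=> mphi phi0 phi1 X.
pose g (x : n.-tuple V * Y) : \bar R := (\prod_i phi i x.2 (tnth x.1 i))%:E.
have mg : measurable_fun setT g.
  apply/measurable_EFinP; apply: measurable_prod => i _.
  have m1 : measurable_fun setT (fun x : n.-tuple V * Y => (x.2, tnth x.1 i)).
    apply/measurable_fun_pair => //.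
    exact: (measurableT_comp (measurable_tnth i) measurable_fst).
  exact: (measurableT_comp (mphi i) m1).
have g0 x : (0 <= g x)%E by rewrite lee_fin prodr_ge0.
split.
- exact: (measurable_giry_int_param (f := fun=> nu) (measurable_cst _) mg g0).
- by move=> ws; apply: integral_ge0 => y _; exact: (g0 (ws, y)).
- have E1 := giry_int_prod1 (tuple_giry (fun _ : 'I_n => mu)) nu mg g0.
  have E2 := giry_int_prod2 (tuple_giry (fun _ : 'I_n => mu)) nu mg g0.
  rewrite E1 {E1} in E2.
  have -> : (\int[tuple_giry (fun _ : 'I_n => mu)]_ws X ws =
    \int[nu]_y \int[tuple_giry (fun _ : 'I_n => mu)]_ws g (ws, y))%E by exact: E2.
  apply: le_trans (@sprobability_setT _ _ _ nu).
  rewrite -[leRHS]mul1e -[leRHS]integral_cst//.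
  apply: ge0_le_integral => //.
  + by move=> y _; apply: integral_ge0.
  + exact: (measurable_fun_fubini_tonelli_G (m1 := tuple_giry (fun _ : 'I_n => mu))).
  + move=> y _; apply: (integral_tuple_giry_prod_le1 (phi := fun i => phi i y)) => // i.
    exact: (measurableT_comp (mphi i) (measurable_pair1 y)).
Qed.

End MomentBounds.

(** * Lower bounds on the Catoni inverses *)

Section CatoniInverse.
Context {R : realType}.

Definition coef (l : R) (n m : nat) : R := l / (n%:R * m%:R).

Lemma coef_ge0 l n m : 0 <= l -> 0 <= coef l n m.
Proof. by move=> l0; rewrite divr_ge0// mulr_ge0. Qed.

Lemma PhiInv_ge N (q : R) (b : \bar R) (lam p : R) : 0 <= p <= 1 ->
  ((- (N%:R * ln (mix (lam / N%:R) p)))%:E <= (lam * q)%:E + b)%E ->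
  p <= PhiInv N q b lam.
Proof.
move=> p01 Hp; apply: sup_upper_bound => //.
by split; [exists p|exists 1 => r [/andP[]]].
Qed.

Lemma PhiInvMulti_ge n (m : 'I_n -> nat) (q : 'I_n -> R) (b : \bar R)
    (lam p : 'I_n -> R) : (0 < n)%N -> (forall i, 0 <= p i <= 1) ->
  ((- \sum_(i < n) (m i)%:R * ln (mix (coef (lam i) n (m i)) (p i)))%:E <=
     (n%:R^-1 * \sum_(i < n) lam i * q i)%:E + b)%E ->
  n%:R^-1 * \sum_(i < n) p i <= PhiInvMulti m q b lam.
Proof.
move=> n0 p01 Hp; apply: sup_upper_bound; last by exists p.
split; first by exists (n%:R^-1 * \sum_(i < n) p i), p.
exists 1 => r [p' [p'01 _ ->]].
rewrite mulrC ler_pdivrMr ?ltr0n// mul1r.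
apply: (@le_trans _ _ (\sum_(i < n) 1)); last by rewrite sumr_const card_ord.
by apply: ler_sum => i _; case/andP: (p'01 i).
Qed.

End CatoniInverse.

(** A countable split over the values of [f]. It handles the random dataset size, on which even the
    tuple type depends. *)
Lemma measurable_nat_param d d' (X : measurableType d) (T : measurableType d')
    (f : X -> nat) (h : nat -> X -> T) :
  measurable_fun setT f -> (forall m, measurable_fun setT (h m)) ->
  measurable_fun setT (fun x => h (f x) x).
Proof.
move=> mf mh _ Y mY; rewrite setTI.
have -> : (fun x => h (f x) x) @^-1` Y =
    \bigcup_m ((f @^-1` [set m]) `&` (h m @^-1` Y)).
  by apply/seteqP; split=> [x Yx|x [m _ [/= <-]]//]; exists (f x).
apply: bigcupT_measurable => m; apply: measurableI.
  by rewrite -[X in measurable X]setTI; exact: mf.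
by rewrite -[X in measurable X]setTI; exact: mh.
Qed.

(** * The two-level bound *)

Section Setting.
Context {R : realType} {dZ dF dA : measure_display}
  {Z : measurableType dZ} {F : measurableType dF} {Alg : measurableType dA}.
Variables (mmax : nat) (tau0 : probability (giry Z R * nat)%type R)
  (loss : F -> Z -> R) (post : Alg -> seq Z -> probability F R).
Hypothesis tau0_supp :
  tau0 [set p : (giry Z R * nat)%type | p.1 setT = 1%E /\ (1 <= p.2 <= mmax)%N] = 1%E.
Hypothesis loss01 : forall f z, 0 <= loss f z <= 1.
Hypothesis mloss : measurable_fun setT (fun p : (F * Z)%type => loss p.1 p.2).
Hypothesis mpost : forall (k : nat) (B : set F), measurable B ->
  measurable_fun setT (fun p : (Alg * k.-tuple Z)%type => post p.1 (tval p.2) B).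

Local Notation W := ((giry Z R * nat) * mmax.-tuple Z)%type.

Definition gpost (A : Alg) (s : seq Z) : giry F R := post A s.

Lemma gpostT A s : gpost A s setT = 1%E.
Proof. exact: probability_setT. Qed.

Lemma measurable_gpost_tuple k :
  measurable_fun setT (fun x : Alg * k.-tuple Z => gpost x.1 (tval x.2)).
Proof. by apply: measurable_giry_codensity => // B mB; exact: mpost. Qed.

Lemma measurable_gpost : measurable_fun setT (fun x : Alg * W => gpost x.1 (taskS x.2)).
Proof.
pose h m (x : Alg * W) := gpost x.1 (take m (tval x.2.2)).
apply: (@measurable_nat_param _ _ _ _ (fun x : Alg * W => x.2.1.2) h) => [|m].
  by apply: measurableT_comp => //; apply: measurableT_comp.
have mt : measurable_fun setT (fun x : Alg * W => (x.1, [tuple of take m x.2.2])).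
  apply/measurable_fun_pair => //; apply/measurable_fun_tnthP => i.
  have im : (i < mmax)%N by rewrite (leq_trans (ltn_ord i))// geq_minr.
  have ii : (i < m)%N by rewrite (leq_trans (ltn_ord i))// geq_minl.
  rewrite (_ : _ \o _ = fun x : Alg * W => tnth x.2.2 (Ordinal im)).
    exact: (measurableT_comp (measurable_tnth (Ordinal im))
      (measurableT_comp measurable_snd measurable_snd)).
  by apply/funext => x /=; rewrite !(tnth_nth point)/= nth_take.
exact: (measurableT_comp (@measurable_gpost_tuple (minn m mmax)) mt).
Qed.

Definition trueLoss (f : F) (D : giry Z R) : R := (\int[D]_z loss f z)%R.

Lemma bmf_loss f : bmf (loss f).
Proof.
apply: (@bmf_itv _ _ _ _ 0 1) => //.
exact: (measurableT_comp mloss (measurable_pair1 f)).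
Qed.

Lemma bmf_lossl z : bmf (loss ^~ z).
Proof.
apply: (@bmf_itv _ _ _ _ 0 1) => //.
exact: (measurableT_comp mloss (measurable_pair2 z)).
Qed.

Lemma trueLoss01 f D : 0 <= trueLoss f D <= 1.
Proof. by apply: bmf_Rintegral_itv => //; exact: bmf_loss. Qed.

Lemma measurable_trueLoss :
  measurable_fun setT (fun x : F * giry Z R => trueLoss x.1 x.2).
Proof.
apply: measurableT_comp => //.
apply: (measurable_giry_int_param
  (g := fun y : (F * giry Z R) * Z => (loss y.1.1 y.2)%:E)) => //.
- have m1 : measurable_fun setT (fun y : (F * giry Z R) * Z => (y.1.1, y.2)).
    by apply/measurable_fun_pair => //; exact: measurableT_comp.
  by apply/measurable_EFinP; exact: (measurableT_comp mloss m1).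
- by move=> y; rewrite lee_fin; case/andP: (loss01 y.1.1 y.2).
Qed.

Lemma bmf_trueLoss D : bmf (trueLoss ^~ D).
Proof.
apply: (@bmf_itv _ _ _ _ 0 1); last by move=> f; exact: trueLoss01.
exact: (measurableT_comp measurable_trueLoss (measurable_pair2 D)).
Qed.

Definition postRisk (A : Alg) (s : seq Z) (D : giry Z R) : R :=
  (\int[gpost A s]_f trueLoss f D)%R.

Lemma postRisk01 A s D : 0 <= postRisk A s D <= 1.
Proof. by apply: bmf_Rintegral_itv; [exact: bmf_trueLoss|move=> f; exact: trueLoss01]. Qed.

Lemma integral_lossQ A s (D : giry Z R) :
  (\int[(D : {measure set Z -> \bar R})]_z lossQ loss (post A s) z)%E =
  (postRisk A s D)%:E.
Proof.
have mL : measurable_fun setT (fun p : F * Z => (loss p.1 p.2)%:E).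
  exact/measurable_EFinP.
have L0 p : (0 <= (loss p.1 p.2)%:E)%E.
  by rewrite lee_fin; case/andP: (loss01 p.1 p.2).
rewrite EFin_Rintegral; last exact: bmf_trueLoss.
have := giry_int_prod2 (gpost A s) D mL L0.
rewrite [X in _ = X -> _]/giry_int => <-.
rewrite giry_int_prod1//; apply: eq_integral => f _.
by rewrite EFin_Rintegral//; exact: bmf_loss.
Qed.

Lemma measurable_mean_trueLoss dX (X : measurableType dX)
    (Q : X -> giry F R) (D : X -> giry Z R) :
  measurable_fun setT Q -> measurable_fun setT D ->
  measurable_fun setT (fun x => \int[Q x]_f trueLoss f (D x))%R.
Proof.
move=> mQ mD; apply: measurableT_comp => //.
apply: (measurable_giry_int_param
  (g := fun y : X * F => (trueLoss y.2 (D y.1))%:E)) => //.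
- have m1 : measurable_fun setT (fun y : X * F => (y.2, D y.1)).
    by apply/measurable_fun_pair => //; exact: measurableT_comp.
  by apply/measurable_EFinP; exact: (measurableT_comp measurable_trueLoss m1).
- by move=> y; rewrite lee_fin; case/andP: (trueLoss01 y.2 (D y.1)).
Qed.

Lemma measurable_taskD : measurable_fun setT (@taskD R dZ Z mmax).
Proof. exact: (measurableT_comp measurable_fst measurable_fst). Qed.

Lemma measurable_taskm : measurable_fun setT (@taskm R dZ Z mmax).
Proof. exact: (measurableT_comp measurable_snd measurable_fst). Qed.

Lemma measurable_postRisk :
  measurable_fun setT (fun x : Alg * W => postRisk x.1 (taskS x.2) (taskD x.2)).
Proof.
apply: measurable_mean_trueLoss; first exact: measurable_gpost.
exact: (measurableT_comp measurable_taskD measurable_snd).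
Qed.

Definition algRisk (A : Alg) (w : W) : R := postRisk A (taskS w) (taskD w).

Lemma algRisk01 A w : 0 <= algRisk A w <= 1.
Proof. exact: postRisk01. Qed.

Lemma measurable_algRisk_task A : measurable_fun setT (algRisk A).
Proof. exact: (measurableT_comp measurable_postRisk (measurable_pair1 A)). Qed.

Lemma bmf_algRisk_alg w : bmf (algRisk ^~ w).
Proof.
apply: (@bmf_itv _ _ _ _ 0 1); last by move=> A; exact: algRisk01.
exact: (measurableT_comp measurable_postRisk (measurable_pair2 w)).
Qed.

(** * The law of a task outcome as a single measure *)

Definition task_kernel (p : (giry Z R * nat)%type) : giry W R :=
  giry_prod (giry_ret p, tuple_giry (fun _ : 'I_mmax => p.1)).

Lemma measurable_sample :
  measurable_fun setT (fun p : (giry Z R * nat)%type =>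
    tuple_giry (fun _ : 'I_mmax => p.1)).
Proof.
apply: (measurable_tuple_giry (f := fun p (_ : 'I_mmax) => p.1)) => i.
exact: measurable_fst.
Qed.

Lemma measurable_task_kernel : measurable_fun setT task_kernel.
Proof.
apply: measurableT_comp; first exact: measurable_giry_prod.
apply/measurable_fun_pair; first exact: measurable_giry_ret.
exact: measurable_sample.
Qed.

Lemma integral_task_kernel p (g : W -> \bar R) :
  measurable_fun setT g -> (forall w, (0 <= g w)%E) ->
  (\int[task_kernel p]_w g w =
   \int[tuple_giry (fun _ : 'I_mmax => p.1)]_zs g (p, zs))%E.
Proof.
move=> mg g0; have := giry_int_prod1 (giry_ret p)
  (tuple_giry (fun _ : 'I_mmax => p.1)) mg g0.
rewrite [X in X = _ -> _]/giry_int => ->; rewrite giry_int_ret//.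
exact: (measurable_fun_fubini_tonelli_F (m2 := tuple_giry (fun _ : 'I_mmax => p.1))).
Qed.

Definition task_giry : giry W R := giry_bind (tau0 : giry _ R) measurable_task_kernel.

Lemma taskInt_giry (g : W -> \bar R) :
  measurable_fun setT g -> (forall w, (0 <= g w)%E) ->
  taskInt tau0 (mmax := mmax) g = (\int[task_giry]_w g w)%E.
Proof.
move=> mg g0; have := giry_int_bind (tau0 : giry _ R) measurable_task_kernel mg g0.
rewrite [X in X = _ -> _]/giry_int => ->; rewrite /taskInt /giry_int.
apply: eq_integral => p _; rewrite integral_task_kernel//.
rewrite /tupleInt tupleIntF_giry//.
exact: (measurableT_comp mg (measurable_pair1 p)).
Qed.

Lemma sampleProb_giry n (G : set (n.-tuple W)) : measurable G ->
  sampleProb tau0 G = tuple_giry (fun _ : 'I_n => task_giry) G.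
Proof.
move=> mG; rewrite /sampleProb (iterFun_giry (mu := task_giry)).
- by rewrite integral_indic// setIT.
- exact: taskInt_giry.
- by apply/measurable_EFinP; exact: measurable_indic.
- by move=> t; rewrite lee_fin.
Qed.

Definition valid_task : set (giry Z R * nat)%type :=
  [set p : (giry Z R * nat)%type | p.1 setT = 1%E /\ (1 <= p.2 <= mmax)%N].

Lemma measurable_valid_task : measurable valid_task.
Proof.
have -> : valid_task = (fun p => giry_ev p.1 setT) @^-1` [set 1%E] `&`
    snd @^-1` [set m : nat | (1 <= m <= mmax)%N] by [].
apply: measurableI; rewrite -[X in measurable X]setTI.
- have m1 : measurable_fun setT (fun p : giry Z R * nat => giry_ev p.1 setT).
    exact: (measurableT_comp (measurable_giry_ev measurableT) measurable_fst).
  exact: m1.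
- exact: measurable_snd.
Qed.

Lemma valid_task_ae : {ae tau0, forall p, valid_task p}.
Proof.
exists (~` valid_task); split => //.
  by apply: measurableC; exact: measurable_valid_task.
rewrite probability_setC ?tau0_supp ?subee//; exact: measurable_valid_task.
Qed.

Lemma task_giryT : task_giry setT = 1%E.
Proof.
rewrite -[LHS]mul1e -[LHS]integral_cst// -taskInt_giry//.
rewrite /taskInt -[RHS](@probability_setT _ _ _ tau0) -[RHS]mul1e -[RHS]integral_cst//.
apply: ae_eq_integral => //.
- under eq_fun => p.
    rewrite /tupleInt tupleIntF_giry//.
    over.
  exact: (measurable_giry_int_param (g := fun=> 1%E) measurable_sample).
- apply: filterS valid_task_ae => p [p1 _] _.
  by rewrite tupleInt_cst.
Qed.

Lemma invalid_task : task_giry [set w | ~ valid_task w.1] = 0%E.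
Proof.
have mV : measurable [set w : W | ~ valid_task w.1].
  rewrite -[X in measurable X]setTI.
  exact: (@measurable_fst _ _ _ _ measurableT _ (measurableC measurable_valid_task)).
have m1 : measurable_fun setT (fun w : W => (\1_[set w | ~ valid_task w.1] w)%:E : \bar R).
  by apply/measurable_EFinP; exact: measurable_indic.
rewrite -[X in task_giry X]setIT -integral_indic// -taskInt_giry//.
rewrite /taskInt -[RHS](integral0 tau0 setT).
apply: ae_eq_integral => //.
- under eq_fun => p.
    rewrite /tupleInt tupleIntF_giry//; last first.
      exact: (measurableT_comp m1 (measurable_pair1 p)).
    over.
  exact: (measurable_giry_int_param measurable_sample m1).
- apply: filterS valid_task_ae => p vp _.
  under [X in tupleInt _ X]eq_fun do rewrite indicE memNset//.
  by rewrite tupleInt_cst//; case: vp.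
Qed.

Definition envRisk (A : Alg) : R := (\int[task_giry]_w algRisk A w)%R.

Lemma bmf_algRisk A : bmf (algRisk A).
Proof.
apply: (@bmf_itv _ _ _ _ 0 1); first exact: measurable_algRisk_task.
by move=> w; exact: algRisk01.
Qed.

Lemma envRisk01 A : 0 <= envRisk A <= 1.
Proof. by apply: bmf_Rintegral_itv; [exact: bmf_algRisk|exact: algRisk01]. Qed.

Lemma measurable_envRisk : measurable_fun setT envRisk.
Proof.
apply: measurableT_comp => //.
apply: (measurable_giry_int_param (f := fun=> task_giry)
  (g := fun x : Alg * W => (algRisk x.1 x.2)%:E)); first exact: measurable_cst.
- by apply/measurable_EFinP; exact: measurable_postRisk.
- by move=> x; rewrite lee_fin; case/andP: (algRisk01 x.1 x.2).
Qed.

Lemma bmf_envRisk : bmf envRisk.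
Proof. by apply: (@bmf_itv _ _ _ _ 0 1); [exact: measurable_envRisk|exact: envRisk01]. Qed.

(** The two sides draw [p.2] and [mmax] samples respectively; they agree on valid tasks, hence
    almost everywhere, by [tupleInt_take]. *)
Lemma metaRiskE (rho : probability Alg R) :
  metaRisk loss post tau0 rho = ((\int[(rho : giry Alg R)]_A envRisk A)%R)%:E.
Proof.
rewrite EFin_Rintegral; last exact: bmf_envRisk.
apply: eq_integral => A _; rewrite EFin_Rintegral; last exact: bmf_algRisk.
rewrite -taskInt_giry; last 2 first.
- by apply/measurable_EFinP; exact: measurable_algRisk_task.
- by move=> w; rewrite lee_fin; case/andP: (algRisk01 A w).
have mpr m : measurable_fun setT
    (fun y : (giry Z R * nat) * m.-tuple Z => (postRisk A (tval y.2) y.1.1)%:E).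
  apply/measurable_EFinP; apply: measurable_mean_trueLoss.
    have m1 : measurable_fun setT
        (fun y : (giry Z R * nat) * m.-tuple Z => (A, y.2)).
      by apply/measurable_fun_pair => //; exact: measurable_cst.
    exact: (measurableT_comp (@measurable_gpost_tuple m) m1).
  exact: (measurableT_comp measurable_fst measurable_fst).
have post0 s D : (0 <= (postRisk A s D)%:E)%E.
  by rewrite lee_fin; case/andP: (postRisk01 A s D).
apply: ae_eq_integral => //.
- pose h m (p : giry Z R * nat) := tupleInt (p.1 : {measure set Z -> \bar R})
    (fun S : m.-tuple Z => \int[(p.1 : {measure set Z -> \bar R})]_z
       lossQ loss (post A (tval S)) z)%E.
  apply: (@measurable_nat_param _ _ _ _ snd h) => [//|m].
  rewrite (_ : h m = fun p => \int[tuple_giry (fun _ : 'I_m => p.1)]_S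
      (postRisk A (tval S) p.1)%:E)%E.
    apply: (measurable_giry_int_param
      (f := fun p : giry Z R * nat => tuple_giry (fun _ : 'I_m => p.1)) _ (mpr m)) => //.
    apply: (measurable_tuple_giry (f := fun p (_ : 'I_m) => p.1)) => i.
    exact: measurable_fst.
  apply/funext => p; rewrite /h.
  under eq_fun do rewrite integral_lossQ.
  rewrite /tupleInt tupleIntF_giry//.
  exact: (measurableT_comp (mpr m) (measurable_pair1 p)).
- have mg p : measurable_fun setT (fun zs : mmax.-tuple Z => (algRisk A (p, zs))%:E).
    apply/measurable_EFinP.
    exact: (measurableT_comp (measurable_algRisk_task A) (measurable_pair1 p)).
  under eq_fun => p.
    rewrite /tupleInt tupleIntF_giry//; last by move=> zs; exact: post0.
    over.
  apply: (measurable_giry_int_param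
    (g := fun x : (giry Z R * nat) * mmax.-tuple Z => (algRisk A x)%:E)
    measurable_sample) => //.
    by apply/measurable_EFinP; exact: measurable_algRisk_task.
  by move=> x; exact: post0.
- apply: filterS valid_task_ae => p [p1 /andP[_ pm]] _.
  under [in LHS]eq_fun do rewrite integral_lossQ.
  by rewrite -(@tupleInt_take _ _ _ _ p.2 mmax (fun s => (postRisk A s p.1)%:E)).
Qed.

(** One normalised exponent per sample, so that [expR] of the sum has mean at most 1 for fixed [f].
    The rate [coef l n m] is the [lambda / (n m)] of [PhiInvMulti]. *)
Definition taskTerm (l : R) (n : nat) (f : F) (w : W) : R :=
  \sum_(z <- taskS w) (- coef l n (taskm w) * loss f z -
     ln (mix (coef l n (taskm w)) (trueLoss f (taskD w)))).

Lemma big_take_tuple k (t : k.-tuple Z) m (psi : Z -> R) :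
  \sum_(z <- take m t) psi z = \sum_(j < k) if (j < m)%N then psi (tnth t j) else 0.
Proof.
elim: k t m => [|k IH] t m; first by rewrite tuple0 big_nil big_ord0.
case/tupleP: t => x t; case: m => [|m].
  by rewrite take0 big_nil big1.
rewrite [take _ _]/= big_cons big_ord_recl tnth0 IH; congr (_ + _).
by apply: eq_bigr => j _; rewrite tnthS.
Qed.

Lemma measurable_taskTerm l n :
  measurable_fun setT (fun x : F * W => taskTerm l n x.1 x.2).
Proof.
pose h m (x : F * W) := \sum_(j < mmax) if (j < m)%N then
  - coef l n m * loss x.1 (tnth x.2.2 j) -
     ln (mix (coef l n m) (trueLoss x.1 (taskD x.2))) else 0.
rewrite (_ : (fun x => _) = fun x => h (taskm x.2) x); last first.
  by apply/funext => x; rewrite /taskTerm /taskS big_take_tuple.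
apply: (@measurable_nat_param _ _ _ _ (fun x : F * W => taskm x.2) h) => [|m].
  exact: (measurableT_comp measurable_taskm measurable_snd).
apply: measurable_sum => j; case: (j < m)%N => //.
apply: measurable_funB.
  apply: measurable_funM => //.
  have m1 : measurable_fun setT (fun x : F * W => (x.1, tnth x.2.2 j)).
    apply/measurable_fun_pair => //.
    exact: (measurableT_comp (measurable_tnth j)
      (measurableT_comp measurable_snd measurable_snd)).
  exact: (measurableT_comp mloss m1).
have m2 : measurable_fun setT (fun x : F * W => (x.1, taskD x.2)).
  apply/measurable_fun_pair => //.
  exact: (measurableT_comp measurable_taskD measurable_snd).
apply: measurable_ln_mix => //.
exact: (measurableT_comp measurable_trueLoss m2).
Qed.

Lemma bmf_taskTerm l n w : 0 <= l -> bmf (fun f => taskTerm l n f w).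
Proof.
move=> l0; apply: bmf_sum => z; apply: bmfD; first exact/bmfZ/bmf_lossl.
under eq_fun do rewrite -mulN1r; apply: bmfZ.
apply: bmf_ln_mix; first exact: coef_ge0.
- by case: (bmf_trueLoss (taskD w)).
- by move=> f; exact: trueLoss01.
Qed.

Lemma taskTerm_moment l n f : 0 <= l ->
  (\int[task_giry]_w (expR (taskTerm l n f w))%:E <= 1)%E.
Proof.
move=> l0.
have mg : measurable_fun setT (fun w => (expR (taskTerm l n f w))%:E).
  apply/measurable_EFinP; apply: measurableT_comp => //.
  exact: (measurableT_comp (measurable_taskTerm l n) (measurable_pair1 f)).
have g0 w : (0 <= (expR (taskTerm l n f w))%:E)%E by rewrite lee_fin expR_ge0.
have := giry_int_bind (tau0 : giry _ R) measurable_task_kernel mg g0.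
rewrite [X in X = _ -> _]/giry_int => ->.
apply: le_trans (@sprobability_setT _ _ _ (tau0 : giry _ R)).
rewrite -[leRHS]mul1e -[leRHS]integral_cst//.
apply: ge0_le_integral => //.
- by move=> p _; exact: integral_ge0.
- exact: (measurableT_comp (measurable_giry_int mg g0) measurable_task_kernel).
move=> p _; rewrite [leLHS]integral_task_kernel//.
set c := coef l n p.2.
pose psi z := - c * loss f z - ln (mix c (trueLoss f p.1)).
(* All [mmax] draws are kept so that independence applies to a fixed product; draws beyond the
   dataset contribute the factor 1. *)
pose phi (j : 'I_mmax) z := if (j < p.2)%N then expR (psi z) else 1.
have mpsi : measurable_fun setT psi.
  apply: measurable_funB => //; apply: measurable_funM => //.
  by case: (bmf_loss f).
under eq_integral => zs _.
  rewrite /taskTerm /taskS big_take_tuple expR_sum.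
  under eq_bigr => j _ do rewrite (fun_if expR) expR0.
  over.
apply: (integral_tuple_giry_prod_le1 (phi := phi)).
- by move=> j; rewrite /phi; case: (j < p.2)%N => //; exact: measurableT_comp.
- by move=> j z; rewrite /phi; case: (j < p.2)%N => //; exact: expR_ge0.
- move=> j; rewrite /phi; case: (j < p.2)%N.
    apply: exp_moment_le1 => //; first exact: coef_ge0.
    by case: (bmf_loss f).
  by rewrite integral_cst// mul1e; exact: (@sprobability_setT _ _ _ p.1).
Qed.

(** The analogue of one summand of [taskTerm], with a whole task as the sample and [algRisk A] as
    the loss. *)
Definition metaTerm (c : R) (A : Alg) (w : W) : R :=
  - c * algRisk A w - ln (mix c (envRisk A)).

Lemma measurable_metaTerm c :
  measurable_fun setT (fun x : Alg * W => metaTerm c x.1 x.2).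
Proof.
apply: measurable_funB.
  by apply: measurable_funM => //; exact: measurable_postRisk.
apply: measurable_ln_mix => //.
exact: (measurableT_comp measurable_envRisk measurable_fst).
Qed.

Lemma bmf_metaTerm c w : 0 <= c -> bmf (fun A => metaTerm c A w).
Proof.
move=> c0; apply: bmfD.
  by apply: bmfZ; exact: bmf_algRisk_alg.
under eq_fun do rewrite -mulN1r; apply: bmfZ.
by apply: bmf_ln_mix => //; [exact: measurable_envRisk|exact: envRisk01].
Qed.

Lemma metaTerm_moment c A : 0 <= c ->
  (\int[task_giry]_w (expR (metaTerm c A w))%:E <= 1)%E.
Proof.
move=> c0; apply: exp_moment_le1 => //; first exact: measurable_algRisk_task.
by move=> w; exact: algRisk01.
Qed.

Lemma measurable_gpost_alg s : measurable_fun setT (fun A => gpost A s).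
Proof.
exact: (measurableT_comp (@measurable_gpost_tuple (size s))
  (measurable_pair2 (in_tuple s))).
Qed.

(** The law of a predictor drawn by choosing [A] from [rho] and then [f] from [post A s]. Empirical
    and true risks are both integrals against it, so a single use of Jensen covers the randomness of
    [A] and of [f]. *)
Definition mixPost (rho : probability Alg R) (s : seq Z) : giry F R :=
  giry_bind (rho : giry Alg R) (measurable_gpost_alg s).

Lemma integral_mixPost rho s (g : F -> \bar R) :
  measurable_fun setT g -> (forall f, (0 <= g f)%E) ->
  (\int[mixPost rho s]_f g f = \int[rho]_A \int[gpost A s]_f g f)%E.
Proof. exact: giry_int_bind. Qed.

Lemma mixPostT rho s : mixPost rho s setT = 1%E.
Proof.
rewrite -[LHS]mul1e -[LHS]integral_cst// integral_mixPost//.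
under eq_integral do rewrite integral_cst1 ?gpostT//.
by rewrite (@integral_cst1 _ _ _ (rho : giry Alg R))//; exact: probability_setT.
Qed.

Lemma empRiskE rho m s : empRisk loss post rho m s =
  m%:R^-1 * \sum_(z <- s) (\int[mixPost rho s]_f loss f z)%R.
Proof.
have ml z : measurable_fun setT (fun f => (loss f z)%:E).
  by apply/measurable_EFinP; case: (bmf_lossl z).
have l0 z f : (0 <= (loss f z)%:E)%E by rewrite lee_fin; case/andP: (loss01 f z).
have mA z : measurable_fun setT (fun A => lossQ loss (post A s) z).
  exact: (measurableT_comp (measurable_giry_int (ml z) (l0 z)) (measurable_gpost_alg s)).
have A0 z A : (0 <= lossQ loss (post A s) z)%E by exact: integral_ge0.
have ms : measurable_fun setT (fun A => \sum_(z <- s) lossQ loss (post A s) z)%E.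
  by apply: emeasurable_sum => z; exact: mA.
have s0 A : (0 <= \sum_(z <- s) lossQ loss (post A s) z)%E.
  by apply: sume_ge0 => z _; exact: A0.
rewrite /empRisk ge0_integralZl ?lee_fin ?invr_ge0//.
rewrite ge0_integral_sum//.
have -> : (\sum_(z <- s) \int[rho]_A lossQ loss (post A s) z)%E =
    (\sum_(z <- s) (\int[mixPost rho s]_f loss f z)%R)%:E.
  rewrite -sumEFin; apply: eq_bigr => z _.
  rewrite EFin_Rintegral; last exact: bmf_lossl.
  by rewrite integral_mixPost.
by [].
Qed.

Lemma mean_algRisk (rho : probability Alg R) w :
  (\int[(rho : giry Alg R)]_A algRisk A w =
   \int[mixPost rho (taskS w)]_f trueLoss f (taskD w))%R.
Proof.
apply: EFin_inj; rewrite !EFin_Rintegral; last 2 first.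
- exact: bmf_trueLoss.
- exact: bmf_algRisk_alg.
rewrite integral_mixPost//.
- by apply: eq_integral => A _; rewrite EFin_Rintegral//; exact: bmf_trueLoss.
- by apply/measurable_EFinP; case: (bmf_trueLoss (taskD w)).
- by move=> f; rewrite lee_fin; case/andP: (trueLoss01 f (taskD w)).
Qed.

Lemma mean_algRisk01 (rho : probability Alg R) w :
  0 <= (\int[(rho : giry Alg R)]_A algRisk A w)%R <= 1.
Proof.
by apply: bmf_Rintegral_itv; [exact: bmf_algRisk_alg|move=> A; exact: algRisk01].
Qed.

Lemma size_taskS (w : W) : valid_task w.1 -> size (taskS w) = taskm w.
Proof. by move=> [_ /andP[_ h]]; rewrite /taskS size_takel// size_tuple. Qed.

(** The empirical part is linear, with [coef] times the dataset size equal to [l / n]. Jensen puts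
    the average inside [ln], turning the [m] normalisers into those of the averaged true risk.
    Validity gives [m >= 1] and a dataset of exactly [m] points. *)
Lemma mean_taskTerm_ge (rho : probability Alg R) l n w :
  (0 < n)%N -> 0 <= l -> valid_task w.1 ->
  - (l / n%:R) * empRisk loss post rho (taskm w) (taskS w) -
    (taskm w)%:R * ln (mix (coef l n (taskm w)) (\int[(rho : giry Alg R)]_A algRisk A w)%R)
  <= (\int[mixPost rho (taskS w)]_f taskTerm l n f w)%R.
Proof.
move=> n0 l0 vw; set c := coef l n (taskm w); set mu := mixPost _ _.
have c0 : 0 <= c by exact: coef_ge0.
have bln : bmf (fun f => - ln (mix c (trueLoss f (taskD w)))).
  under eq_fun do rewrite -mulN1r; apply: bmfZ.
  apply: bmf_ln_mix => //; first by case: (bmf_trueLoss (taskD w)).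
  by move=> f; exact: trueLoss01.
have bl z : bmf (fun f => - c * loss f z) by exact/bmfZ/bmf_lossl.
rewrite /taskTerm bmf_Rintegral_sum => [|z]; last exact: bmfD.
have E z : (\int[mu]_f (- c * loss f z - ln (mix c (trueLoss f (taskD w)))) =
    - c * \int[mu]_f loss f z + \int[mu]_f - ln (mix c (trueLoss f (taskD w))))%R.
  by rewrite bmf_RintegralD// bmf_RintegralZ//; exact: bmf_lossl.
under eq_bigr do rewrite E.
rewrite big_split/= -mulr_sumr big_const_seq count_predT iter_addr_0 size_taskS//.
have m0 : (taskm w)%:R != 0 :> R.
  by rewrite pnatr_eq0 -lt0n; case: vw => _ /andP[].
have nn0 : n%:R != 0 :> R by rewrite pnatr_eq0 -lt0n.
rewrite empRiskE -/mu.
have -> : - (l / n%:R) * ((taskm w)%:R^-1 * \sum_(z <- taskS w) (\int[mu]_f loss f z)%R)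
    = - c * \sum_(z <- taskS w) (\int[mu]_f loss f z)%R.
  by rewrite /c /coef; field; rewrite m0 nn0.
rewrite lerD2l mean_algRisk -[leRHS]mulr_natl -mulrN ler_wpM2l//.
have -> : (\int[mu]_f - ln (mix c (trueLoss f (taskD w))) =
    - \int[mu]_f ln (mix c (trueLoss f (taskD w))))%R.
  under eq_Rintegral do rewrite -mulN1r.
  rewrite bmf_RintegralZ ?mulN1r//; apply: bmf_ln_mix => //.
    by case: (bmf_trueLoss (taskD w)).
  by move=> f; exact: trueLoss01.
rewrite lerN2; apply: jensen_ln_mix => //.
- by case: (bmf_trueLoss (taskD w)).
- by move=> f; exact: trueLoss01.
- exact: mixPostT.
Qed.

(** * Marginals of the hyper-distributions on the predictors *)

Section hyper.
Variable n : nat.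

Lemma measurable_tuple_iid :
  measurable_fun setT (fun P : giry F R => tuple_giry (fun _ : 'I_n => P)).
Proof. exact: (measurable_tuple_giry (f := fun P (_ : 'I_n) => P)). Qed.

Definition hyperPrior (P : probability (giry F R) R) : giry (n.-tuple F) R :=
  giry_bind (P : giry (giry F R) R) measurable_tuple_iid.

Lemma indic_snd (B : set (n.-tuple F)) (P : giry F R) fs :
  \1_[set x : giry F R * n.-tuple F | B x.2] (P, fs) = \1_B fs :> R.
Proof. by rewrite !indicE; congr (nat_of_bool _)%:R; apply/idP/idP; rewrite !inE. Qed.

Lemma frakPE (Ph : probability (giry F R) R) B : measurable B ->
  frakP (n := n) Ph [set x | B x.2] = hyperPrior Ph B.
Proof.
move=> mB; have mB1 : measurable_fun setT (fun t : n.-tuple F => (\1_B t)%:E : \bar R).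
  by apply/measurable_EFinP; exact: measurable_indic.
have B0 t : (0 <= (\1_B t)%:E :> \bar R)%E by rewrite lee_fin.
have := giry_int_bind (Ph : giry (giry F R) R) measurable_tuple_iid mB1 B0.
rewrite /giry_int integral_indic// setIT => E; rewrite [RHS]E /frakP.
apply: eq_integral => P _.
under [X in tupleInt _ X]eq_fun do rewrite indic_snd.
by rewrite /tupleInt tupleIntF_giry.
Qed.

Definition jointPost (S : 'I_n -> seq Z) (A : Alg) : giry (n.-tuple F) R :=
  tuple_giry (fun i => gpost A (S i)).

Lemma measurable_jointPost S : measurable_fun setT (jointPost S).
Proof.
apply: (measurable_tuple_giry (f := fun A i => gpost A (S i))) => i.
exact: measurable_gpost_alg.
Qed.

Lemma jointPostT S A : jointPost S A setT = 1%E.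
Proof. by apply: tuple_giryT => i; exact: gpostT. Qed.

Lemma frakQE S (Qh : probability (giry F R) R) A B : measurable B ->
  frakQ post S Qh A [set x | B x.2] = jointPost S A B.
Proof.
move=> mB; have mB1 : measurable_fun setT (fun t : n.-tuple F => (\1_B t)%:E : \bar R).
  by apply/measurable_EFinP; exact: measurable_indic.
rewrite /frakQ (_ : (fun P => _) = fun=> jointPost S A B).
  by rewrite (@integral_cst1 _ _ _ (Qh : giry _ R))//; exact: probability_setT.
apply/funext => P; under [X in tupleIntF _ X]eq_fun do rewrite indic_snd.
have := tupleIntF_giry (fun i => gpost A (S i)) mB1.
rewrite integral_indic// setIT; apply => t.
by rewrite lee_fin.
Qed.

(** Data processing: a partition of the tuples of predictors pulls back along the second projection
    to a partition admissible in [KL]. *)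
Lemma KL_frak_ge S (Qh Ph : probability (giry F R) R) A
    K (B : 'I_K -> set (n.-tuple F)) :
  mpartition B ->
  (\sum_k klterm (jointPost S A (B k)) (hyperPrior Ph (B k)) <=
    KL (frakQ post S Qh A) (frakP (n := n) Ph))%E.
Proof.
move=> [mB tB UB]; apply: ereal_sup_ubound.
exists K, (fun k => [set x | B k x.2]); split.
- move=> k; rewrite -[X in measurable X]setTI.
  exact: (@measurable_snd _ _ _ _ measurableT _ (mB k)).
- by move=> i j _ _ [x [Bi Bj]]; apply: tB => //; exists x.2.
- apply/seteqP; split => // x _.
  by have : (\bigcup_(k in setT) B k) x.2 by [rewrite UB]; move=> [k _ Bk]; exists k.
- by apply: eq_bigr => k _; rewrite frakQE// frakPE.
Qed.

Lemma KL_frak_ge0 S (Qh Ph : probability (giry F R) R) A :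
  (0 <= KL (frakQ post S Qh A) (frakP (n := n) Ph))%E.
Proof.
have TT : [set: giry F R * n.-tuple F] = [set x | [set: n.-tuple F] x.2].
  by apply/seteqP; split.
apply: KL_ge0; rewrite TT ?frakQE// ?frakPE// ?jointPostT//.
by rewrite measure_ge0 sprobability_setT.
Qed.

Definition tupleTerm (lam : 'I_n -> R) (w : n.-tuple W) (fs : n.-tuple F) : R :=
  \sum_i taskTerm (lam i) n (tnth fs i) (tnth w i).

Lemma bmf_taskTerm_tnth (lam : 'I_n -> R) w i : (forall i, 0 <= lam i) ->
  bmf (fun fs : n.-tuple F => taskTerm (lam i) n (tnth fs i) (tnth w i)).
Proof.
move=> lam0; have [mt [b tb]] := bmf_taskTerm n (tnth w i) (lam0 i).
split; last by exists b => fs; exact: tb.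
exact: (measurableT_comp mt (measurable_tnth i)).
Qed.

(** Under the [rho]-mixture the predictors are dependent through the common [A], but [tupleTerm] is
    additive, so only the marginals matter, and the [i]-th one is [mixPost] of the [i]-th
    dataset. *)
Lemma mean_tupleTerm (rho : probability Alg R) (lam : 'I_n -> R) w :
  (forall i, 0 <= lam i) ->
  let S := fun i => taskS (tnth w i) in
  (\int[giry_bind (rho : giry Alg R) (measurable_jointPost S)]_fs tupleTerm lam w fs =
   \sum_i \int[mixPost rho (S i)]_f taskTerm (lam i) n f (tnth w i))%R.
Proof.
move=> lam0 S; rewrite /tupleTerm bmf_Rintegral_sum => [|i]; last exact: bmf_taskTerm_tnth.
have bindE (g : n.-tuple F -> \bar R) : measurable_fun setT g -> (forall t, (0 <= g t)%E) ->
    (\int[giry_bind (rho : giry Alg R) (measurable_jointPost S)]_t g t =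
     \int[rho]_A \int[jointPost S A]_t g t)%E by exact: giry_int_bind.
apply: eq_bigr => i _.
apply: (@bmf_Rintegral_comp _ _ _ _ _ (@tnth n F ^~ i) _ _
  (fun f => taskTerm (lam i) n f (tnth w i))).
- exact: measurable_tnth.
- rewrite -[LHS]mul1e -[LHS]integral_cst// bindE//.
  under eq_integral do rewrite integral_cst1 ?jointPostT//.
  by rewrite (@integral_cst1 _ _ _ (rho : giry Alg R))//; exact: probability_setT.
- exact: mixPostT.
- move=> g mg g0; rewrite bindE//; last first.
    exact: (measurableT_comp mg (measurable_tnth i)).
  rewrite integral_mixPost//; apply: eq_integral => A _.
  by rewrite /jointPost integral_tuple_giry_tnth// => j; exact: gpostT.
- exact: bmf_taskTerm.
Qed.

End hyper.

Lemma task_bound n (rho : probability Alg R) (lam : 'I_n -> R) (w : n.-tuple W)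
    (C : \bar R) :
  (0 < n)%N -> (forall i, 0 <= lam i) -> (forall i, valid_task (tnth w i).1) ->
  let S := fun i => taskS (tnth w i) in
  let m := fun i => taskm (tnth w i) in
  (((\int[giry_bind (rho : giry Alg R) (measurable_jointPost S)]_fs
       tupleTerm lam w fs)%R)%:E <= C)%E ->
  ((- \sum_(i < n) (m i)%:R * ln (mix (coef (lam i) n (m i))
       (\int[(rho : giry Alg R)]_A algRisk A (tnth w i))%R))%:E <=
   (n%:R^-1 * \sum_(i < n) lam i * empRisk loss post rho (m i) (S i))%:E + C)%E.
Proof.
move=> n0 lam0 vw S m H; rewrite -leeBlDl// -EFinB; apply: le_trans H.
rewrite lee_fin mean_tupleTerm// mulr_sumr -sumrN -sumrB.
apply: ler_sum => i _; apply: le_trans (mean_taskTerm_ge rho n0 (lam0 i) (vw i)).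
by rewrite addrC mulNr mulrCA mulrA.
Qed.

Lemma meta_bound n (rho : probability Alg R) (l : R) (w : n.-tuple W) (C : \bar R) :
  (0 < n)%N -> 0 <= l ->
  (\int[rho]_A (\sum_(i < n) metaTerm (l / n%:R) A (tnth w i))%:E <= C)%E ->
  ((- (n%:R * ln (mix (l / n%:R) (\int[(rho : giry Alg R)]_A envRisk A)%R)))%:E <=
   (l * (n%:R^-1 * \sum_(i < n) (\int[(rho : giry Alg R)]_A algRisk A (tnth w i))%R))%:E
     + C)%E.
Proof.
move=> n0 l0 H; rewrite -leeBlDl// -EFinB; apply: le_trans H.
set c := l / n%:R; have c0 : 0 <= c by rewrite divr_ge0.
have bm i : bmf (fun A => metaTerm c A (tnth w i)) by exact: bmf_metaTerm.
rewrite -(@EFin_Rintegral _ _ _ (rho : giry Alg R)); last exact: bmf_sum.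
rewrite lee_fin bmf_Rintegral_sum//.
have bln : bmf (fun A => ln (mix c (envRisk A))).
  by apply: bmf_ln_mix => //; [exact: measurable_envRisk|exact: envRisk01].
have br i : bmf (fun A => algRisk A (tnth w i)).
  exact: bmf_algRisk_alg.
have J := jensen_ln_mix (mu := (rho : giry Alg R)) c0 measurable_envRisk envRisk01
  (@probability_setT _ _ _ rho).
rewrite [leLHS](_ : _ = \sum_(i < n)
   (- c * (\int[(rho : giry Alg R)]_A algRisk A (tnth w i))%R
   - ln (mix c (\int[(rho : giry Alg R)]_A envRisk A)%R))).
  apply: ler_sum => i _.
  have -> : (\int[(rho : giry Alg R)]_A metaTerm c A (tnth w i))%R =
      (\int[(rho : giry Alg R)]_A (- c * algRisk A (tnth w i) +
         (-1) * ln (mix c (envRisk A))))%R.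
    by apply: eq_Rintegral => A _; rewrite mulN1r.
  rewrite bmf_RintegralD ?bmf_RintegralZ//; [|exact: bmfZ..].
  by rewrite lerD2l mulN1r lerN2.
move: (ln (mix c _)) => x.
rewrite big_split/= -mulr_sumr sumr_const card_ord -(mulr_natl (- x)) /c; ring.
Qed.

Lemma valid_sample n :
  let P := tuple_giry (fun _ : 'I_n => task_giry) in
  let G := [set w : n.-tuple W | forall i, valid_task (tnth w i).1] in
  measurable G /\ P (~` G) = 0%E.
Proof.
move=> P G; pose N := [set w : W | ~ valid_task w.1].
have mN : measurable N.
  rewrite -[X in measurable X]setTI.
  exact: (@measurable_fst _ _ _ _ measurableT _ (measurableC measurable_valid_task)).
have GE : ~` G = \bigcup_(i in setT) [set w : n.-tuple W | N (tnth w i)].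
  apply/seteqP; split=> [w /existsNP[i Ni]|w [i _ Ni] Gw]; first by exists i.
  exact: Ni (Gw i).
have mGc : measurable (~` G).
  rewrite GE; apply: fin_bigcup_measurable => [|i _]; first exact: finite_finset.
  by rewrite -[X in measurable X]setTI; exact: (measurable_tnth i measurableT mN).
split; first by rewrite -[G]setCK; exact: measurableC.
have m1 : measurable_fun setT (fun w : W => (\1_N w)%:E : \bar R).
  by apply/measurable_EFinP; exact: measurable_indic.
have mt i : measurable_fun setT (fun w : n.-tuple W => (\1_N (tnth w i))%:E : \bar R).
  exact: (measurableT_comp m1 (measurable_tnth i)).
apply/eqP; rewrite eq_le measure_ge0 andbT -[~` G]setIT -integral_indic//.
apply: (@le_trans _ _ (\int[P]_w \sum_(i < n) (\1_N (tnth w i))%:E)%E).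
  apply: ge0_le_integral => //.
  - by apply/measurable_EFinP; exact: measurable_indic.
  - exact: emeasurable_sum.
  - move=> w _; rewrite sumEFin lee_fin indicE.
    have [|_] := boolP (w \in ~` G); last by rewrite sumr_ge0.
    rewrite inE GE => -[i _ Ni]; rewrite (bigD1 i)//= indicE mem_set//.
    by rewrite lerDl sumr_ge0.
rewrite ge0_integral_sum// big1// => i _.
apply/eqP; rewrite eq_le integral_ge0// andbT.
have N0 : (\int[task_giry]_w (\1_N w)%:E = 0)%E.
  by rewrite integral_indic// setIT; exact: invalid_task.
rewrite -[leRHS]N0.
apply: (integral_tuple_giry_tnth_le (fun _ : 'I_n => task_giry) i m1) => w.
by rewrite lee_fin.
Qed.

Lemma pac_bayes_bound n (pi : probability Alg R)
    (Ph : Alg -> probability (giry F R) R) (delta lamM : R) (lam : 'I_n -> R) :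
  (0 < n)%N -> 0 < delta -> 0 < lamM -> (forall i, 0 < lam i) ->
  exists G : set (n.-tuple W),
    [/\ measurable G, ((1 - delta)%:E <= sampleProb tau0 G)%E &
        forall w, G w ->
        let m := fun i : 'I_n => taskm (tnth w i) in
        let S := fun i : 'I_n => taskS (tnth w i) in
        forall (rho : probability Alg R)
               (Qh : Alg -> probability (giry F R) R),
          (forall A, Qh A [set P : giry F R | P setT = 1%E] = 1%E) ->
          measurable_fun setT
            (fun A => KL (frakQ post S (Qh A) A) (frakP (n := n) (Ph A))) ->
          let C := (KL rho pi
                    + \int[rho]_A KL (frakQ post S (Qh A) A) (frakP (n := n) (Ph A))
                    + (ln (2 / delta))%:E)%E in
          (metaRisk loss post tau0 rho
            <= (PhiInv n
                  (PhiInvMulti m (fun i => empRisk loss post rho (m i) (S i)) C lam)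
                  (KL rho pi + (ln (2 / delta))%:E)%E lamM)%:E)%E].
Proof.
move=> n0 delta0 lamM0 lam0'; have lam0 i : 0 <= lam i by exact: ltW.
have d20 : 0 < 2 / delta by rewrite divr_gt0.
pose c := lamM / n%:R; have c0 : 0 <= c by rewrite divr_ge0// ltW.
pose p A (B : set (n.-tuple F)) := fine (hyperPrior n (Ph A) B).
have pfin A B : measurable B -> hyperPrior n (Ph A) B = (p A B)%:E.
  by move=> mB; rewrite /p fineK// fin_num_measure.
have p0 A B : 0 <= p A B by rewrite fine_ge0.
have pT A : p A setT <= 1 by rewrite -lee_fin -pfin// sprobability_setT.
have pU A B B' : measurable B -> measurable B' -> B `&` B' = set0 ->
    p A (B `|` B') = p A B + p A B'.
  move=> mB mB' BB'; apply: EFin_inj; rewrite EFinD -!pfin//; last exact: measurableU.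
  by rewrite measureU.
(* [Mc] depends on [pi] and [Ph] only, so an event defined with it serves all [rho] and [Qh] at
   once. *)
have [Mc HMc] := nonmeasurable_mixture pi p0 pT pU.
have [mX1 X10 X1le] := @prior_moment_le1 _ _ _ _ _ task_giry (pi : giry Alg R) n
  (fun _ A w => expR (metaTerm c A w))
  (fun _ => measurableT_comp (@measurable_expR R) (measurable_metaTerm c))
  (fun _ A w => expR_ge0 _) (fun _ A => metaTerm_moment A c0).
have mphi2 i : measurable_fun setT (fun x : n.-tuple F * W =>
    expR (taskTerm (lam i) n (tnth x.1 i) x.2)).
  apply: measurableT_comp => //.
  have m1 : measurable_fun setT (fun x : n.-tuple F * W => (tnth x.1 i, x.2)).
    apply/measurable_fun_pair => //.
    exact: (measurableT_comp (measurable_tnth i) measurable_fst).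
  exact: (measurableT_comp (measurable_taskTerm (lam i) n) m1).
have [mX2 X20 X2le] := @prior_moment_le1 _ _ _ _ _ task_giry Mc n
  (fun i fs w => expR (taskTerm (lam i) n (tnth fs i) w)) mphi2
  (fun _ _ _ => expR_ge0 _) (fun i fs => taskTerm_moment n (tnth fs i) (lam0 i)).
(* At level [2 / delta] Markov leaves mass at most [delta / 2], and the logarithm of this level is
   the constant in both complexity terms. *)
have [mG1 PG1] := markov_le1 mX1 X10 d20 X1le.
have [mG2 PG2] := markov_le1 mX2 X20 d20 X2le.
have [mG0 PG0] := valid_sample n.
move: mX1 X10 X1le mX2 X20 X2le mG1 PG1 mG2 PG2 mG0 PG0.
set X1 := fun ws : n.-tuple W => (\int[pi : giry Alg R]__ _)%E.
set X2 := fun ws : n.-tuple W => (\int[Mc]__ _)%E.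
set G1 := [set t | (X1 t <= _)%E]; set G2 := [set t | (X2 t <= _)%E].
set G0 := [set w | forall i, _]; set P := tuple_giry _.
move=> _ _ _ _ _ _ mG1 PG1 mG2 PG2 mG0 PG0.
have mG : measurable (G0 `&` (G1 `&` G2)) by apply: measurableI => //; exact: measurableI.
exists (G0 `&` (G1 `&` G2)); split => //.
  rewrite sampleProb_giry// -/P.
  have PT : P setT = 1%E by apply: tuple_giryT => i; exact: task_giryT.
  have : (P (~` (G0 `&` (G1 `&` G2))) <= delta%:E)%E.
    have mc (B : set (n.-tuple W)) : measurable B -> measurable (~` B) by exact: measurableC.
    rewrite !setCI; apply: le_trans (measureU2 _ _ _) _ => //.
      by apply: mc.
      by apply: measurableU; exact: mc.
    rewrite [X in (X + _)%E](_ : _ = 0%E) ?add0e//.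
    apply: le_trans (measureU2 _ _ _) _; [exact: mc..|].
    apply: le_trans (leeD PG1 PG2) _.
    by rewrite -EFinD lee_fin invf_div; lra.
  rewrite -(setvU (G0 `&` (G1 `&` G2))) measureU// in PT; last 2 first.
  - exact: measurableC.
  - by rewrite setICl.
  have f1 : P (G0 `&` (G1 `&` G2)) \is a fin_num by exact: fin_num_measure.
  have f2 : P (~` (G0 `&` (G1 `&` G2))) \is a fin_num.
    by apply: fin_num_measure; exact: measurableC.
  have {}PT : (P (G0 `&` (G1 `&` G2)) + P (~` (G0 `&` (G1 `&` G2))) = 1)%E.
    by rewrite addeC; exact: PT.
  rewrite -(fineK f1) -(fineK f2) in PT *; move: PT => [PT]; rewrite !lee_fin; lra.
move=> w [Gw0 [Gw1 Gw2]] m S rho Qh _ mKL.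
cbv zeta; set C := (KL rho pi + _ + _)%E.
have Gw0' i : valid_task (tnth w i).1 := Gw0 i.
set K := (KL rho pi + (ln (2 / delta))%:E)%E.
have meta : (\int[rho]_A (\sum_(i < n) metaTerm c A (tnth w i))%:E <= K)%E.
  have [mv [b vb]] : bmf (fun A => \sum_(i < n) metaTerm c A (tnth w i)).
    by apply: bmf_sum => i; exact: bmf_metaTerm.
  apply: (@donsker_varadhan _ _ _ rho pi _ b _ mv vb d20).
  rewrite [leLHS](_ : _ = X1 w); first exact: Gw1.
  by apply: eq_integral => A _; rewrite expR_sum.
have task : (((\int[giry_bind (rho : giry Alg R) (measurable_jointPost S)]_fs
       tupleTerm lam w fs)%R)%:E <= C)%E.
  have bt : bmf (tupleTerm lam w).
    by apply: bmf_sum => i; exact: bmf_taskTerm_tnth.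
  have [mu [b ub]] := bt.
  rewrite EFin_Rintegral//.
  rewrite /C.
  apply: (HMc rho (giry_bind (rho : giry Alg R) (measurable_jointPost S)) (jointPost S)
    (fun A => KL (frakQ post S (Qh A) A) (frakP (n := n) (Ph A)))
    _ _ _ mKL _ _ _ _ _ mu ub d20).
  - by move=> A; exact: jointPostT.
  - move=> B mB; exact: (measurableT_comp (measurable_giry_ev mB) (measurable_jointPost S)).
  - move=> B mB.
    have mB1 : measurable_fun setT (fun t : n.-tuple F => (\1_B t)%:E : \bar R).
      by apply/measurable_EFinP; exact: measurable_indic.
    have := giry_int_bind (rho : giry Alg R) (measurable_jointPost S) mB1.
    rewrite /giry_int integral_indic// setIT => ->; last by move=> t; rewrite lee_fin.
    by apply: eq_integral => A _; rewrite integral_indic// setIT.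
  - by move=> A; exact: KL_frak_ge0.
  - move=> A k B pB; apply: le_trans (KL_frak_ge S (Qh A) (Ph A) A pB).
    by apply: lee_sum => j _; rewrite pfin//; case: pB.
  - rewrite [leLHS](_ : _ = X2 w); first exact: Gw2.
    by apply: eq_integral => fs _; rewrite expR_sum.
rewrite metaRiskE lee_fin.
apply: PhiInv_ge.
  exact: (@bmf_Rintegral_itv _ _ _ (rho : giry Alg R) _ bmf_envRisk envRisk01).
apply: le_trans (meta_bound n0 (ltW lamM0) meta) _.
(* Monotonicity in [q] with [lamM > 0]: it remains to bound the mean true risk over the training
   tasks by the inner inverse. *)
rewrite leeD2r// lee_fin ler_wpM2l ?(ltW lamM0)//.
apply: PhiInvMulti_ge => //; first by move=> i; exact: mean_algRisk01.
exact: task_bound.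
Qed.

End Setting.

Theorem mainTheorem11 (R : realType) (dZ dF dA : measure_display)
  (Z : measurableType dZ) (F : measurableType dF) (Alg : measurableType dA)
  (mmax n : nat)
  (tau0 : probability (giry Z R * nat)%type R)
  (loss : F -> Z -> R)
  (post : Alg -> seq Z -> probability F R)
  (pi : probability Alg R)
  (Ph : Alg -> probability (giry F R) R)
  (delta lamM : R) (lam : 'I_n -> R) :
  (0 < n)%N ->
  tau0 [set p : (giry Z R * nat)%type | p.1 setT = 1%E /\ (1 <= p.2 <= mmax)%N] = 1%E ->
  (forall f z, 0 <= loss f z <= 1) ->
  measurable_fun setT (fun p : (F * Z)%type => loss p.1 p.2) ->
  (forall (k : nat) (B : set F), measurable B ->
     measurable_fun setT
       (fun p : (Alg * k.-tuple Z)%type => post p.1 (tval p.2) B)) ->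
  (forall A, Ph A [set P : giry F R | P setT = 1%E] = 1%E) ->
  0 < delta -> 0 < lamM -> (forall i, 0 < lam i) ->
  exists G : set (n.-tuple ((giry Z R * nat) * mmax.-tuple Z)%type),
    [/\ measurable G,
        ((1 - delta)%:E <= sampleProb tau0 G)%E &
        forall w, G w ->
        let m := fun i : 'I_n => taskm (tnth w i) in
        let S := fun i : 'I_n => taskS (tnth w i) in
        forall (rho : probability Alg R)
               (Qh : Alg -> probability (giry F R) R),
          (forall A, Qh A [set P : giry F R | P setT = 1%E] = 1%E) ->
          measurable_fun setT
            (fun A => KL (frakQ post S (Qh A) A) (frakP (n := n) (Ph A))) ->
          let C := (KL rho pi
                    + \int[rho]_A KL (frakQ post S (Qh A) A) (frakP (n := n) (Ph A))
                    + (ln (2 / delta))%:E)%E in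
          (metaRisk loss post tau0 rho
            <= (PhiInv n
                  (PhiInvMulti m (fun i => empRisk loss post rho (m i) (S i)) C lam)
                  (KL rho pi + (ln (2 / delta))%:E)%E lamM)%:E)%E].
Proof.
move=> n0 tau0_supp loss01 mloss mpost _ delta0 lamM0 lam0.
exact: (pac_bayes_bound tau0_supp loss01 mloss mpost pi Ph n0 delta0 lamM0 lam0).
Qed.
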